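(* Let $s>0$. If $f\in L^2(\mathbb R^n)$ is non-zero and $s$-concave, then \[\frac1{\big((n+\frac2s)\mathrm{B}(\beta+1,n+\frac2s)\big)^{1/\beta}}\,\mathrm{R}_\beta f\subseteq\frac1{\big((n+\frac2s)\mathrm{B}(\alpha+1,n+\frac2s)\big)^{1/\alpha}}\,\mathrm{R}_\alpha f\] for all $-1<\alpha<\beta<\infty$.
   Context: $f:\mathbb R^n\to[0,\infty)$ is $s$-concave ($s>0$) if $f^s$ is concave on the support of $f$. $\mathrm{B}$ is the Beta function, extended to negative first argument in $(-1,0)$ by analytic continuation. Star-shaped sets are described by radial functions on $\mathbb S^{n-1}$; $\lambda K$ has radial function $\lambda\rho_K$; $K\subseteq L$ means $\rho_K\le\rho_L$. For non-negative non-zero $f\in L^2(\mathbb R^n)$: for $\alpha>0$, $\rho_{\mathrm{R}_\alpha f}(\xi)^\alpha=\frac{\alpha}{\Vert f\Vert_2^2}\int_0^\infty t^{\alpha-1}\int_{\mathbb R^n}f(x)f(x+t\xi)\,dx\,dt$; for $-1<\alpha<0$, $\rho_{\mathrm{R}_\alpha f}(\xi)^\alpha=\frac{|\alpha|}{2\Vert f\Vert_2^2}\int_0^\infty t^{\alpha-1}\int_{\mathbb R^n}|f(x+t\xi)-f(x)|^2\,dx\,dt$; and $\log\rho_{\mathrm{R}_0 f}(\xi)=-\gamma+\int_0^\infty\frac1t\big(\frac1{\Vert f\Vert_2^2}\int_{\mathbb R^n}f(x)f(x+t\xi)\,dx-e^{-t}\big)\,dt$, $\gamma$ Euler's constant.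 At index $0$ the normalizing factor is interpreted as the limit as the index tends to $0$. *)

(* Defs.v *)
From HB Require Import structures.
From mathcomp Require Import all_boot all_order all_algebra.
From mathcomp Require Import all_classical all_reals all_analysis.
Set Implicit Arguments. Unset Strict Implicit. Unset Printing Implicit Defensive.
Import Order.TTheory GRing.Theory Num.Theory.
Import numFieldNormedType.Exports.
Local Open Scope classical_set_scope.
Local Open Scope ring_scope.

Section Defs.
Variable R : realType.
Local Notation leb := (@lebesgue_measure R).

(* Lebesgue integral over R^n (R^n = 'rV[R]_n) of a non-negative function,
   computed as the iterated one-dimensional Lebesgue integral (Tonelli). *)
Fixpoint intRn (n : nat) : ('rV[R]_n -> \bar R) -> \bar R :=
  match n with
  | 0 => fun g => g 0
  | m.+1 => fun g =>
      (\int[leb]_x intRn (fun v : 'rV[R]_m =>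
         g (row_mx (const_mx (x : R) : 'rV[R]_1) v : 'rV[R]_m.+1)))%E
  end.

Definition L2norm2 n (f : 'rV[R]_n -> R) : \bar R := intRn (fun x => (f x ^+ 2)%:E).

(* f is (non-negative and) s-concave: f^s concave on the support {f > 0}
   (this forces the support to be convex). *)
Definition s_concave n (s : R) (f : 'rV[R]_n -> R) : Prop :=
  (forall x, 0 <= f x) /\
  forall x y (l : R), 0 < f x -> 0 < f y -> 0 <= l <= 1 ->
    (1 - l) * (f x `^ s) + l * (f y `^ s) <= f ((1 - l) *: x + l *: y) `^ s.

Definition unit_sphere n (xi : 'rV[R]_n) : Prop := \sum_(i < n) (xi 0 i) ^+ 2 = 1.

Definition Beta (a b : R) : R :=
  fine (\int[leb]_(t in `]0%R, 1%R[) ((t `^ (a - 1)) * ((1 - t) `^ (b - 1)))%:E)%E.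

Definition euler_gamma : R :=
  lim ((fun m : nat => series harmonic m - ln m%:R) @ \oo).

Definition covf n (f : 'rV[R]_n -> R) (xi : 'rV[R]_n) (t : R) : \bar R :=
  intRn (fun x => (f x * f (x + t *: xi))%:E).

Definition diff2f n (f : 'rV[R]_n -> R) (xi : 'rV[R]_n) (t : R) : \bar R :=
  intRn (fun x => ((f (x + t *: xi) - f x) ^+ 2)%:E).

(* the 1/a-th power of x in [0, +oo], for a <> 0, with 0^(neg) = +oo, +oo^(neg) = 0 *)
Definition eroot (x : \bar R) (a : R) : \bar R :=
  if 0 < a then (x `^ a^-1)%E
  else match x with
       | r%:E => if r == 0 then +oo%E else (r `^ a^-1)%:E
       | +oo%E => 0%E
       | -oo%E => 0%E
       end.

(* radial function of the radial mean body R_a f in direction xi *)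
Definition radialR n (a : R) (f : 'rV[R]_n -> R) (xi : 'rV[R]_n) : \bar R :=
  let N := fine (L2norm2 f) in
  if 0 < a then
    eroot ((a / N)%:E *
      \int[leb]_(t in `]0%R, +oo[) ((t `^ (a - 1))%:E * covf f xi t))%E a
  else if a < 0 then
    eroot ((`|a| / (2 * N))%:E *
      \int[leb]_(t in `]0%R, +oo[) ((t `^ (a - 1))%:E * diff2f f xi t))%E a
  else
    expeR ((- euler_gamma)%:E +
      \int[leb]_(t in `]0%R, +oo[)
         ((t^-1)%:E * (covf f xi t * (N^-1)%:E - (expR (- t))%:E)))%E.

Definition normfac0 n (s a : R) : R :=
  ((n%:R + 2 / s) * Beta (a + 1) (n%:R + 2 / s)) `^ (- a^-1).

Definition normfac n (s a : R) : R :=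
  if a == 0 then lim (normfac0 n s a @[a --> 0^']) else normfac0 n s a.

End Defs.

(* Main.v *)
(* For a unit vector [xi], the normalized covariogram [h t = covf f xi t / |f|_2^2] has
   [h 0 = 1] and is [1/p]-concave with [p = n + 2/s], by the Borell-Brascamp-Lieb inequality
   (fiberwise: layer cake, one-dimensional Brunn-Minkowski for intervals, Hoelder).  All three
   definitions of the radius are increasing functions of [phi a h], a regularization of
   [\int_0^oo t^(a-1) h t dt].  For the model [(1 - t/c)_+^p] the radius is [c] divided by
   [normfac n s a].  Choose [c] so that [h] and the model agree in [phi a]; concavity of
   [h^(1/p)] makes [h - model] change sign only once, from [+] to [-], so [phi b h] is at most
   [phi b] of the model for every [b > a]. *)
Require Import Defs.
From HB Require Import structures.
From mathcomp Require Import all_boot all_order all_algebra.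
From mathcomp Require Import all_classical all_reals all_analysis.
From mathcomp Require Import measurable_realfun ring lra.
Set Implicit Arguments. Unset Strict Implicit. Unset Printing Implicit Defensive.
Import Order.TTheory GRing.Theory Num.Theory.
Import numFieldNormedType.Exports.
Local Open Scope classical_set_scope.
Local Open Scope ring_scope.

(** * Lower integrals and change of variables *)

(** [s_concave] says nothing about measurability, and [intRn] is a tower of lower integrals;
    measurability has to be recovered from concavity. Superlevel sets of a power-concave function of
    one variable are intervals, and each integration over a coordinate preserves power concavity,
    the exponent going from [1/r] to [1/(r+1)]. The product [f x * f (x + t *: xi)] starts with
    [r = 2/s], jointly in [x] and [t], so [n] integrations produce [p = n + 2/s]. The squared
    difference in [diff2f] has no concavity of its own. It is reached through [2 f(x) f(y) + (f(y) -
    f(x))^2 = f(x)^2 + f(y)^2] and an additivity of the lower integral in which only one summand has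
    to be measurable. Index [0] brings two limits, Euler's constant in [radialR] and the limit in
    [normfac]. The first is absorbed when the reference [expR (- t)] is replaced by the indicator of
    [t < 1]; the second comes from [a * phi a = 1 + a * phi 0 + O(a^2)] for the model. *)

Section LowerIntegral.
Local Open Scope ereal_scope.
Context d (T : measurableType d) (R : realType).
Variable mu : {measure set T -> \bar R}.
Import HBNNSimple.

(** Every simple function below [f] is also below [g], so the supremum defining the integral can
    only grow; this serves for integrands not known to be measurable. *)
Lemma le_lower_integral (D : set T) (f g : T -> \bar R) :
  (forall x, D x -> 0 <= f x) -> (forall x, D x -> f x <= g x) ->
  \int[mu]_(x in D) f x <= \int[mu]_(x in D) g x.
Proof.
move=> f0 fg; rewrite !ge0_integralE//; last first.
  by move=> x Dx; rewrite (le_trans (f0 x Dx))// fg.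
apply: ge_ereal_sup => _ [h /= hf <-]; apply: ereal_sup_ubound.
exists h => //= x; rewrite (le_trans (hf x))// /patch.
by case: ifPn => // /set_mem; exact: fg.
Qed.

(* For non-negative integrands [\int] is a supremum over the simple functions below, whether
   or not they are measurable; [g] will be the integrand of [diff2f]. *)
Lemma lower_integralD (c g : T -> \bar R) :
  measurable_fun setT c -> (forall x, 0 <= c x) -> (forall x, 0 <= g x) ->
  \int[mu]_x (c x + g x) = \int[mu]_x c x + \int[mu]_x g x.
Proof.
move=> mc c0 g0; apply/eqP; rewrite eq_le; apply/andP; split.
  rewrite ge0_integralTE; last by move=> x; exact: adde_ge0.
  apply: ge_ereal_sup => _ [h /= hcg <-].
  (* The part of [h] that exceeds [c]: it is measurable because [c] and [h] are, it lies below [g],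
     and [h <= c + k]. *)
  pose k x := maxe ((h x)%:E - c x) 0.
  have mh : measurable_fun setT (EFin \o h) by exact/measurable_EFinP.
  have mk : measurable_fun setT k.
    by apply: measurable_maxe => //; apply: emeasurable_funB.
  have k0 x : 0 <= k x by rewrite /k le_max lexx orbT.
  rewrite -integralT_nnsfun; apply: (@le_trans _ _ (\int[mu]_x (c x + k x))).
    apply: le_lower_integral => x _; first by rewrite lee_fin fun_ge0.
    rewrite /k; have := c0 x; case: (c x) => [r|_|//]; last first.
      by rewrite addye ?leey// gt_eqF// (lt_le_trans ltNy0)// le_max lexx orbT.
    rewrite lee_fin -EFinB => r0; rewrite -EFin_max -EFinD lee_fin.
    by rewrite -lerBlDl le_max lexx.
  rewrite ge0_integralD//; apply: leeD2l; apply: le_lower_integral => // x _.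
  rewrite /k ge_max g0 andbT; have := hcg x; have := c0 x; have := g0 x.
  case: (c x) => [r| |]//; last by rewrite /= leNye.
  by case: (g x) => [q| |]//= _ _; rewrite ?leey// -?EFinD ?lee_fin lerBlDl.
(* For the converse, a finite [\int c] can be moved to the other side, and then each simple function
   below [g] is treated separately; an infinite one makes both sides infinite. *)
rewrite [X in _ + X]ge0_integralTE//.
have := mc; have [|] := leP +oo (\int[mu]_x c x).
  rewrite leye_eq => /eqP cy _.
  have : \int[mu]_x c x <= \int[mu]_x (c x + g x).
    by apply: le_lower_integral => // x _; rewrite leeDl.
  by rewrite cy leye_eq => /eqP ->; rewrite leey.
move=> cy _.
have cfin : \int[mu]_x c x \is a fin_num.
  by rewrite ge0_fin_numE//; exact: integral_ge0.
rewrite addeC -leeBrDr//; apply: ge_ereal_sup => _ [h /= hg <-].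
rewrite leeBrDr// addeC -integralT_nnsfun -ge0_integralD//; last 2 first.
  by move=> x _; rewrite lee_fin fun_ge0.
  exact/measurable_EFinP.
apply: le_lower_integral => x _; first by rewrite adde_ge0// lee_fin fun_ge0.
exact: leeD2l.
Qed.

End LowerIntegral.

Section Affine.
Context {R : realType}.
Local Notation mu := (@lebesgue_measure R).

(** The image of Lebesgue measure under [x |-> c * x + e], multiplied by [c], gives every half-open
    interval its length, hence is Lebesgue measure by uniqueness. *)
Lemma ge0_integral_affine (c e : R) (f : R -> \bar R) : 0 < c ->
  measurable_fun setT f -> (forall x, 0 <= f x)%E ->
  (\int[mu]_x f x = c%:E * \int[mu]_x f (c * x + e)%R)%E.
Proof.
move=> c0 mf f0.
pose phi : R -> measurableTypeR R := fun x => c * x + e.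
have mphi : measurable_fun setT phi.
  by apply: measurable_funD => //; exact: measurable_funM.
pose cn : {nonneg R} := NngNum (ltW c0).
pose pm : {measure set (measurableTypeR R) -> \bar R} :=
  measure_function_pushforward__canonical__measure_function_Measure mu mphi.
have E A : measurable A -> mu A = mscale cn pm A.
  apply: lebesgue_measure_unique => _ [[a b]] _ <-.
  change (mu `]a, b]%classic = c%:E * mu (phi @^-1` `]a, b]%classic))%E.
  have -> : phi @^-1` `]a, b]%classic = `](a - e) / c, (b - e) / c]%classic.
    by apply/seteqP; split => x /=; rewrite !in_itv/= /phi
      ltr_pdivrMr// ler_pdivlMr// ltrBlDr lerBrDr [x * c]mulrC.
  rewrite !lebesgue_measure_itv/= !lte_fin ltr_pM2r ?invr_gt0// ltrD2r.
  case: ifPn => _; last by rewrite mule0.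
  rewrite -!EFinB -EFinM; congr EFin; field; exact: lt0r_neq0.
transitivity (\int[mscale cn pm]_x f x)%E.
  by apply: eq_measure_integral => A mA _; exact: E.
rewrite ge0_integral_mscale//=; congr (_ * _)%E.
by rewrite /pm ge0_integral_pushforward.
Qed.

End Affine.

(** * Power means, layer cake, one-dimensional Brunn-Minkowski *)

Section PowerMean.
Context {R : realType}.
Implicit Types r l a b : R.

(** The weighted power mean of exponent [1/r]. The parameter is [r] and not [1/r] because [r] is
    what grows by [1] with every integration. *)
Definition pmean r l a b := ((1 - l) * a `^ r^-1 + l * b `^ r^-1) `^ r.

Lemma pmean_gt0 r l a b : 0 <= l <= 1 -> 0 < a -> 0 < b -> 0 < pmean r l a b.
Proof.
move=> /andP[l0 l1] a0 b0; apply: powR_gt0.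
have A := powR_gt0 r^-1 a0; have B := powR_gt0 r^-1 b0.
have [->|l0'] := eqVneq l 0; first by rewrite subr0 mul1r mul0r addr0.
by rewrite ltr_wpDl ?mulr_ge0 ?subr_ge0 ?(ltW A)// mulr_gt0// lt0r l0'.
Qed.

Lemma pmeanZ r l t a b : 0 < r -> 0 <= l <= 1 -> 0 <= t -> 0 <= a -> 0 <= b ->
  pmean r l (t * a) (t * b) = t * pmean r l a b.
Proof.
move=> r0 /andP[l0 l1] t0 a0 b0; rewrite /pmean !powRM//.
have -> : (1 - l) * (t `^ r^-1 * a `^ r^-1) + l * (t `^ r^-1 * b `^ r^-1) =
  t `^ r^-1 * ((1 - l) * a `^ r^-1 + l * b `^ r^-1) by ring.
rewrite powRM ?powR_ge0 ?addr_ge0 ?mulr_ge0 ?subr_ge0 ?powR_ge0//.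
by rewrite -powRrM mulVf ?gt_eqF// powRr1.
Qed.

Lemma pmean_id r l a : 0 < r -> 0 <= a -> pmean r l a a = a.
Proof.
move=> r0 a0; rewrite /pmean -mulrDl subrK mul1r -powRrM mulVf ?gt_eqF//.
exact: powRr1.
Qed.

Lemma hoelder2_powR (x0 x1 y0 y1 t u : R) : 0 <= x0 -> 0 <= x1 -> 0 <= y0 ->
  0 <= y1 -> 0 < t -> 0 < u -> t + u = 1 ->
  x0 `^ t * y0 `^ u + x1 `^ t * y1 `^ u <= (x0 + x1) `^ t * (y0 + y1) `^ u.
Proof.
move=> x00 x10 y00 y10 t0 u0 tu.
have tV : t * t^-1 = 1 by rewrite divff// gt_eqF.
have uV : u * u^-1 = 1 by rewrite divff// gt_eqF.
have := @hoelder2 R _ _ _ _ t^-1 u^-1 (powR_ge0 x0 t) (powR_ge0 x1 t)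
  (powR_ge0 y0 u) (powR_ge0 y1 u).
rewrite !invr_gt0 !invrK => /(_ t0 u0 tu).
by rewrite -!powRrM tV uV !powRr1.
Qed.

(** Hoelder with weights [t = r/(r+1)] and [u = 1/(r+1)], applied to [w * m^(1/r)] and [w * (c/m)]:
    since [t/r = u], the powers of [m] cancel and [w * c^u] remains. This raises [r] to [r + 1] once
    the levels have been normalized by [m0] and [m1]. *)
Lemma pmean_hoelder r l m0 m1 a b : 0 < r -> 0 <= l <= 1 ->
  0 < m0 -> 0 < m1 -> 0 <= a -> 0 <= b ->
  pmean (r + 1) l a b <= pmean r l m0 m1 * ((1 - l) * (a / m0) + l * (b / m1)).
Proof.
move=> r0 /andP[l0 l1] m00 m10 a0 b0.
have r1 : 0 < r + 1 by lra.
have ol : 0 <= 1 - l by rewrite subr_ge0.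
pose t := r / (r + 1); pose u := (r + 1)^-1.
have t0 : 0 < t by rewrite divr_gt0.
have u0 : 0 < u by rewrite invr_gt0.
have tu : t + u = 1 by rewrite /t /u; field; exact: lt0r_neq0.
have rt : r^-1 * t = u by rewrite /t /u; field; rewrite !lt0r_neq0.
have tr : t * (r + 1) = r by rewrite /t; field; exact: lt0r_neq0.
have ur : u * (r + 1) = 1 by rewrite /u; field; exact: lt0r_neq0.
rewrite /pmean -/u; clearbody t u.
have key w m c : 0 <= w -> 0 < m -> 0 <= c ->
    (w * m `^ r^-1) `^ t * (w * (c / m)) `^ u = w * c `^ u.
  move=> w0 m0' c0.
  have cm0 : 0 <= c / m by rewrite divr_ge0// ltW.
  rewrite (powRM _ w0 (powR_ge0 _ _)) (powRM _ w0 cm0).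
  rewrite -powRrM rt mulrACA -powRD tu ?oner_eq0// powRr1//.
  rewrite -(powRM _ (ltW m0') cm0).
  by have -> : m * (c / m) = c by field; exact: lt0r_neq0.
have x00 : 0 <= (1 - l) * m0 `^ r^-1 by rewrite mulr_ge0 ?powR_ge0.
have x10 : 0 <= l * m1 `^ r^-1 by rewrite mulr_ge0 ?powR_ge0.
have y00 : 0 <= (1 - l) * (a / m0) by rewrite mulr_ge0 ?divr_ge0// ltW.
have y10 : 0 <= l * (b / m1) by rewrite mulr_ge0 ?divr_ge0// ltW.
have k0 := key _ _ _ ol m00 a0; have k1 := key _ _ _ l0 m10 b0.
have := hoelder2_powR x00 x10 y00 y10 t0 u0 tu.
move: ((1 - l) * m0 `^ r^-1) (l * m1 `^ r^-1) x00 x10 k0 k1 => x0 x1 x00 x10.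
move: ((1 - l) * (a / m0)) (l * (b / m1)) y00 y10 => y0 y1 y00 y10 -> ->.
have : 0 <= (1 - l) * a `^ u + l * b `^ u.
  by rewrite addr_ge0// mulr_ge0 ?powR_ge0.
move: ((1 - l) * a `^ u + l * b `^ u) => z z0 zH.
apply: le_trans (ge0_ler_powR (ltW r1) _ _ zH) _; rewrite ?nnegrE//.
  by rewrite mulr_ge0 ?powR_ge0.
rewrite powRM ?powR_ge0// -!powRrM tr ur powRr1//; exact: addr_ge0.
Qed.

End PowerMean.

Section LayerCake.
Context {R : realType}.
Local Notation mu := (@lebesgue_measure R).
Local Open Scope ereal_scope.

(** The subgraph of [g] cut at height [m], with its vertical coordinate divided by [m]. After this
    rescaling, functions of different heights can be compared level by level at the same [t]. *)
Let cake (g : R -> \bar R) (m : R) : set (R * R) :=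
  [set z | (0 < z.2 < 1)%R /\ (z.2 * m)%:E < g z.1].

Let measurable_cake (g : R -> \bar R) m : measurable_fun setT g ->
  measurable (cake g m).
Proof.
move=> mg.
have m1 : measurable_fun [set: R * R] (fun z => (z.2 * m)%:E).
  by apply/measurable_EFinP; exact: measurable_funM.
have m2 : measurable_fun [set: R * R] (fun z => g z.1).
  exact: measurableT_comp.
have -> : cake g m = (@snd R R) @^-1` `]0%R, 1%R[%classic `&`
    (setT `&` [set z | (z.2 * m)%:E < g z.1]).
  apply/seteqP; split => z; rewrite /cake/= in_itv/=; first by case.
  by case=> ? [_ ?].
apply: measurableI; last exact: measurable_lte.
by rewrite -[X in measurable X]setTI; exact: measurable_snd.
Qed.

Lemma measurable_level_measure (g : R -> \bar R) (m : R) : measurable_fun setT g ->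
  measurable_fun (`]0%R, 1%R[%classic : set R) (fun t => mu [set x | (t * m)%:E < g x]).
Proof.
move=> mg; have mc := measurable_cake m mg.
have := measurable_fun_ysection mu mc.
move/(measurable_funS measurableT (@subsetT R `]0%R, 1%R[%classic)).
apply: eq_measurable_fun => t; rewrite inE/= in_itv/= => t01.
congr (mu _); apply/seteqP; split => x; rewrite /ysection/= inE /cake/=.
  by case.
by split.
Qed.

(** Tonelli for the indicator of [cake g m]: the section at [x] has length [min (g x) m / m], the
    section at height [t] is a superlevel set of [g]. *)
Lemma layer_cake (g : R -> \bar R) (m : R) : (0 < m)%R -> measurable_fun setT g ->
  (forall x, 0 <= g x) ->
  \int[mu]_x mine (g x) m%:E =
  m%:E * \int[mu]_(t in `]0%R, 1%R[) mu [set x | (t * m)%:E < g x].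
Proof.
move=> m0 mg g0; have mc := measurable_cake m mg.
have mind : measurable_fun setT (fun z : R * R => (\1_(cake g m) z : R)%:E).
  by apply/measurable_EFinP.
have := @fubini_tonelli _ _ _ _ R mu mu _ mind (fun z => ltac:(by rewrite lee_fin)).
have L x : \int[mu]_y (\1_(cake g m) (x, y) : R)%:E = mine (g x) m%:E * (m^-1)%:E.
  rewrite [LHS](_ : _ = \int[mu]_y (\1_(xsection (cake g m) x) y : R)%:E); last first.
    by apply: eq_integral => y _; rewrite !indicE mem_xsection.
  rewrite integral_indic//; last exact: measurable_xsection.
  rewrite setIT.
  have [gm|gm] := leP m%:E (g x).
    rewrite -EFinM divff ?gt_eqF//.
    have -> : xsection (cake g m) x = `]0%R, 1%R[%classic.
      apply/seteqP; split => y; rewrite /xsection/= inE /cake/= in_itv/=.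
        by case.
      move=> y01; split => //; rewrite (lt_le_trans _ gm)// lte_fin.
      by rewrite gtr_pMl//; case/andP: y01.
    transitivity (mu `]0%R, 1%R[%classic) => //.
    by rewrite lebesgue_measure_itv/= lte01 sube0.
  have gf : g x \is a fin_num by rewrite ge0_fin_numE// (lt_trans gm)// ltry.
  rewrite -(fineK gf) -EFinM.
  have -> : xsection (cake g m) x = `]0%R, (fine (g x) / m)%R[%classic.
    apply/seteqP; split => y; rewrite /xsection/= inE /cake/= in_itv/=.
      case=> /andP[y0 y1]; rewrite -(fineK gf) lte_fin => yg.
      by rewrite y0/= ltr_pdivlMr.
    move=> /andP[y0]; rewrite ltr_pdivlMr// => yg.
    rewrite -(fineK gf) lte_fin; split => //; rewrite y0/=.
    rewrite -(@ltr_pM2r _ m)// mul1r (lt_trans yg)//.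
    by rewrite -lte_fin fineK.
  transitivity (mu `]0%R, (fine (g x) / m)%R[%classic) => //.
  rewrite lebesgue_measure_itv/= lte_fin sube0; case: ifPn => //.
  rewrite -leNgt => h; congr EFin; apply/eqP; rewrite eq_le h.
  by rewrite divr_ge0 ?fine_ge0// ltW.
have Rr y : \int[mu]_x (\1_(cake g m) (x, y) : R)%:E =
    ((fun t => mu [set x | (t * m)%:E < g x]) \_ `]0%R, 1%R[) y.
  rewrite [LHS](_ : _ = \int[mu]_x (\1_(ysection (cake g m) y) x : R)%:E); last first.
    by apply: eq_integral => x _; rewrite !indicE mem_ysection.
  rewrite integral_indic//; last exact: measurable_ysection.
  rewrite setIT /patch; case: ifPn.
    rewrite inE/= in_itv/= => y01; congr (mu _).
    by apply/seteqP; split => x; rewrite /ysection/= inE /cake/=; tauto.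
  rewrite notin_setE/= in_itv/= => y01.
  rewrite (_ : ysection _ _ = set0) ?measure0//; apply/seteqP; split => x //.
  by rewrite /ysection/= inE /cake/=; tauto.
under eq_integral do rewrite L.
under [RHS]eq_integral do rewrite Rr.
rewrite -integral_mkcond ge0_integralZr//; last 3 first.
- by apply: measurable_mine.
- by move=> x _; rewrite le_min g0 lee_fin ltW.
- by rewrite lee_fin invr_ge0 ltW.
move=> <-; rewrite muleCA -EFinM divff ?gt_eqF// mule1//.
Qed.

End LayerCake.

Section OneDim.
Context {R : realType}.
Local Notation mu := (@lebesgue_measure R).

(** If no two points of [A] were more than [u] apart, [A] would lie in [[inf A, sup A]], of length
    at most [u]. A negative [u] is allowed and gives [x = y], which covers sets reduced to a
    point. *)
Lemma interval_length_approx (A : set R) (u : R) : is_interval A -> A !=set0 ->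
  (u%:E < mu A)%E -> exists x y, [/\ A x, A y, x <= y & u < y - x].
Proof.
move=> iA [x0 Ax0] uA.
have [u0|u0] := ltP u 0; first by exists x0, x0; split => //; rewrite subrr.
apply: contrapT => H.
have {}H x y : A x -> A y -> y - x <= u.
  move=> Ax Ay; rewrite leNgt; apply/negP => uyx; apply: H; exists x, y.
  by split => //; rewrite -subr_ge0 (le_trans _ (ltW uyx)).
have hs : has_sup A.
  by split; [exists x0|exists (x0 + u) => y Ay; rewrite -lerBlDl H].
have hi : has_inf A.
  by split; [exists x0|exists (x0 - u) => y Ay; rewrite lerBlDr -lerBlDl H].
have AI : A `<=` `[inf A, sup A].
  move=> y Ay /=; rewrite in_itv/= (ub_le_sup _ Ay) ?(ge_inf _ Ay)//.
  - by case: hi.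
  - by case: hs.
have SI : sup A - inf A <= u.
  rewrite lerBlDl; apply: ge_sup; first by exists x0.
  move=> y Ay; rewrite -lerBlDr; apply: lb_le_inf; first by exists x0.
  by move=> z Az; rewrite lerBlDr -lerBlDl H.
have : (mu A <= u%:E)%E.
  apply: (@le_trans _ _ (mu `[inf A, sup A]%classic)).
    by apply: le_measure; rewrite ?inE//; exact: is_interval_measurable.
  rewrite lebesgue_measure_itv/= lte_fin; case: ifPn => _; last by rewrite lee_fin.
  by rewrite -EFinB lee_fin.
by rewrite leNgt uA.
Qed.

(** Segments of [A] and [B] of nearly full length combine into a segment of [C]: a point of the
    latter is reached by running through both segments with the same parameter. *)
Lemma brunn_minkowski_interval (A B C : set R) (l : R) : 0 < l < 1 ->
  is_interval A -> is_interval B -> A !=set0 -> B !=set0 -> measurable C ->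
  (forall x y, A x -> B y -> C ((1 - l) * x + l * y)) ->
  ((1 - l)%:E * mu A + l%:E * mu B <= mu C)%E.
Proof.
move=> /andP[l0 l1] iA iB A0 B0 mC ABC.
have ol : 0 < 1 - l by rewrite subr_gt0.
have key u v : (u%:E < mu A)%E -> (v%:E < mu B)%E ->
    (((1 - l) * u + l * v)%:E <= mu C)%E.
  move=> uA vB.
  have [x [y [Ax Ay xy uxy]]] := interval_length_approx iA A0 uA.
  have [x' [y' [Bx By xy' vxy]]] := interval_length_approx iB B0 vB.
  pose p := (1 - l) * x + l * x'; pose q := (1 - l) * y + l * y'.
  have pq : p <= q by rewrite lerD ?ler_pM2l.
  have sub : `[p, q]%classic `<=` C.
    move=> z /=; rewrite in_itv/= => /andP[pz zq].
    have [pq0|pq0] := eqVneq p q.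
      have -> : z = p by apply/eqP; rewrite eq_le pz pq0 zq.
      exact: ABC.
    have qp0 : 0 < q - p by rewrite subr_gt0 lt_neqAle pq0.
    pose t := (z - p) / (q - p).
    have t0 : 0 <= t by rewrite divr_ge0 ?subr_ge0// ltW.
    have t1 : t <= 1 by rewrite ler_pdivrMr// mul1r lerD2r.
    have zE : z = (1 - l) * (x + t * (y - x)) + l * (x' + t * (y' - x')).
      transitivity (p + t * (q - p)); last by rewrite /p /q; ring.
      by rewrite /t divfK ?gt_eqF// addrC subrK.
    rewrite zE; apply: ABC.
      by apply: (iA x y) => //; apply/andP; split; nra.
    by apply: (iB x' y') => //; apply/andP; split; nra.
  apply: (@le_trans _ _ (mu `[p, q]%classic)).
    rewrite lebesgue_measure_itv/= lte_fin lt_neqAle pq andbT.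
    have h : (1 - l) * u + l * v <= q - p.
      have -> : q - p = (1 - l) * (y - x) + l * (y' - x') by rewrite /p /q; ring.
      by rewrite lerD// ler_pM2l// ltW.
    case: eqVneq => [pq0|_] /=; last by rewrite -EFinB lee_fin.
    by move: h; rewrite pq0 subrr lee_fin.
  by apply: le_measure; rewrite ?inE.
have muA0 := measure_ge0 mu A; have muB0 := measure_ge0 mu B.
have N1 D : (0 <= mu D -> (-1)%:E < mu D)%E.
  by apply: lt_le_trans; rewrite lte_fin; lra.
have [->|Cy] := eqVneq (mu C) +oo%E; first by rewrite leey.
have Cf : mu C \is a fin_num by rewrite ge0_fin_numE ?measure_ge0// ltey.
have [c cE] : exists c, mu C = c%:E by exists (fine (mu C)); rewrite fineK.
(* An infinite [mu A] would allow [u] so large that, even against [v = -1], [key] yields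
   [c + 1 <= c]. *)
have Af : mu A \is a fin_num.
  rewrite ge0_fin_numE// ltNge leye_eq; apply/negP => /eqP Ay.
  have := key ((c + 1 + l) / (1 - l)) (-1); rewrite Ay ltry => /(_ isT (N1 _ muB0)).
  rewrite cE lee_fin mulrC divfK ?gt_eqF//; lra.
have Bf : mu B \is a fin_num.
  rewrite ge0_fin_numE// ltNge leye_eq; apply/negP => /eqP By.
  have := key (-1) ((c + 1 + (1 - l)) / l) (N1 _ muA0); rewrite By ltry => /(_ isT).
  rewrite cE lee_fin [l * _]mulrC divfK ?gt_eqF//; lra.
move: Af Bf key; rewrite cE => /fineK <- /fineK <- key.
rewrite -!EFinM -EFinD lee_fin; apply/ler_addgt0Pr => e e0.
have := key (fine (mu A) - e) (fine (mu B) - e).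
rewrite !lte_fin !ltrBlDr !ltrDl e0 lee_fin => /(_ isT isT); lra.
Qed.

(** The level is [sup f] when this is finite, and otherwise a large integer supplied by monotone
    convergence. All superlevel sets at [t * m] must be non-empty, as Brunn-Minkowski fails for an
    empty summand. *)
Lemma truncation_level (f : R -> \bar R) (a : R) : measurable_fun setT f ->
  (forall x, 0 <= f x)%E -> 0 < a -> (a%:E < \int[mu]_x f x)%E ->
  exists m : R, [/\ 0 < m, (forall t, 0 < t < 1 -> exists x, ((t * m)%:E < f x)%E)
    & (a%:E < \int[mu]_x mine (f x) m%:E)%E].
Proof.
move=> mf f0 a0 af.
pose S := ereal_sup (range f).
have fS x : (f x <= S)%E by apply: ereal_sup_ubound; exists x.
have S0 : (0 < S)%E.
  rewrite ltNge; apply/negP => S0.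
  have : (\int[mu]_x f x = 0)%E.
    apply: integral0_eq => x _; apply/eqP; rewrite eq_le f0 andbT.
    exact: le_trans (fS x) S0.
  by move=> h; move: af; rewrite h lte_fin ltNge ltW.
have [Sy|Sy] := eqVneq S +oo%E; last first.
  have Sf : S \is a fin_num by rewrite ge0_fin_numE ?ltW// ltey.
  have SE : S = (fine S)%:E by rewrite fineK.
  have s0 : 0 < fine S by rewrite -lte_fin -SE.
  exists (fine S); split => //.
    move=> t /andP[t0 t1].
    have : ((t * fine S)%:E < S)%E by rewrite SE lte_fin/= gtr_pMl.
    by move/ereal_sup_gt => [_ [x _ <-] h]; exists x.
  suff -> : (\int[mu]_x mine (f x) (fine S)%:E = \int[mu]_x f x)%E by [].
  by apply: eq_integral => x _; rewrite -SE min_l.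
have lev (m : R) (t : R) : exists x, ((t * m)%:E < f x)%E.
  have : ((t * m)%:E < S)%E by rewrite Sy ltry.
  by move/ereal_sup_gt => [_ [x _ <-] h]; exists x.
pose g (n : nat) x := mine (f x) n%:R%:E.
have limg x : limn (g ^~ x) = f x.
  apply/cvg_lim => //; have := f0 x; rewrite /g; case: (f x) => [r|_|//].
    move=> r0; apply: cvg_near_cst; near=> n.
    rewrite min_l// lee_fin; near: n; exact: nbhs_infty_ger.
  rewrite (_ : (fun _ => _) = fun n => n%:R%:E); last by apply/funext => n.
  by apply/cvgenyP.
have := @monotone_convergence _ _ R mu setT measurableT g.
have mg n : measurable_fun setT (g n) by apply: measurable_mine.
have g0 n x : setT x -> (0 <= g n x)%E by move=> _; rewrite le_min f0 lee_fin ler0n.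
have ndg x : setT x -> {homo g ^~ x : n m / (n <= m)%N >-> (n <= m)%E}.
  move=> _ n m nm; rewrite /g le_min ge_min lexx/= ge_min lee_fin ler_nat nm.
  by rewrite orbT.
move=> /(_ mg g0 ndg); under eq_integral do rewrite limg.
have ndi : {homo (fun n => \int[mu]_x g n x)%E : n m / (n <= m)%N >-> (n <= m)%E}.
  by move=> n m nm; apply: le_lower_integral => x Tx; [exact: g0|exact: ndg].
rewrite (cvg_lim _ (ereal_nondecreasing_cvgn ndi))// => E.
move: af; rewrite E => /ereal_sup_gt[_ [n _ <-] H].
exists n%:R; split => //.
rewrite ltr0n lt0n; apply/eqP => n0.
have : (\int[mu]_x g n x = 0)%E.
  by apply: integral0_eq => x _; rewrite /g n0 min_r.
by move=> h; move: H; rewrite h lte_fin ltNge ltW.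
Unshelve. all: by end_near. Qed.

End OneDim.

(** * The Borell-Brascamp-Lieb inequality *)

Section BBL.
Context {R : realType}.
Local Notation mu := (@lebesgue_measure R).

(** By homogeneity of [pmean], the levels [t * m0] of [f0] and [t * m1] of [f1] combine into the
    level [t * M] of [f]. One-dimensional Brunn-Minkowski at each [t], the layer cake formula and
    [pmean_hoelder] then give the exponent [1/(r+1)]. *)
Lemma bbl_integral (r l : R) (f0 f1 f : R -> \bar R) : 0 < r -> 0 < l < 1 ->
  measurable_fun setT f0 -> measurable_fun setT f1 -> measurable_fun setT f ->
  (forall x, 0 <= f0 x)%E -> (forall x, 0 <= f1 x)%E -> (forall x, 0 <= f x)%E ->
  (forall c : R, is_interval [set x | (c%:E < f0 x)%E]) ->
  (forall c : R, is_interval [set x | (c%:E < f1 x)%E]) ->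
  (forall x y a b, 0 < a -> 0 < b -> (a%:E < f0 x)%E -> (b%:E < f1 y)%E ->
    ((pmean r l a b)%:E <= f ((1 - l) * x + l * y)%R)%E) ->
  forall a b, 0 < a -> 0 < b ->
  (a%:E < \int[mu]_x f0 x)%E -> (b%:E < \int[mu]_x f1 x)%E ->
  ((pmean (r + 1) l a b)%:E <= \int[mu]_x f x)%E.
Proof.
move=> r0 l01 mf0 mf1 mf f00 f10 fge0 i0 i1 H a b a0 b0 af bf.
have l01' : 0 <= l <= 1 by case/andP: l01 => /ltW -> /ltW.
have [m0 [m00 lev0 am]] := truncation_level mf0 f00 a0 af.
have [m1 [m10 lev1 bm]] := truncation_level mf1 f10 b0 bf.
have lt1 : 0 < 1 - l by case/andP: l01 => _; rewrite subr_gt0.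
have l0 : 0 < l by case/andP: l01.
pose M := pmean r l m0 m1.
have M0 : 0 < M by exact: pmean_gt0.
pose G0 t := mu [set x | ((t * m0)%:E < f0 x)%E].
pose G1 t := mu [set x | ((t * m1)%:E < f1 x)%E].
pose G t := mu [set x | ((t * M)%:E < f x)%E].
have mG0 : measurable_fun (`]0%R, 1%R[%classic : set R) G0 by exact: measurable_level_measure.
have mG1 : measurable_fun (`]0%R, 1%R[%classic : set R) G1 by exact: measurable_level_measure.
have bm01 t : 0 < t < 1 -> ((1 - l)%:E * G0 t + l%:E * G1 t <= G t)%E.
  move=> t01; apply: brunn_minkowski_interval => //.
  - by have [x xt] := lev0 _ t01; exists x.
  - by have [x xt] := lev1 _ t01; exists x.
  - rewrite -[X in measurable X]setTI; exact: emeasurable_fun_o_infty.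
  move=> x y /= xt yt.
  have /andP[t0 t1] := t01.
  (* The hypothesis on [f] yields only a weak inequality; raising [t] slightly makes it strict at
     [t * M]. *)
  have tri (m : R) (z : \bar R) : 0 < m -> ((t * m)%:E < z)%E ->
      exists2 t', t < t' & ((t' * m)%:E < z)%E.
    case: z => [z| |//] m0'.
      rewrite lte_fin -ltr_pdivlMr// => tz.
      exists ((t + z / m) / 2); first lra.
      by rewrite lte_fin -ltr_pdivlMr//; lra.
    by move=> _; exists (t + 1); [lra|rewrite ltry].
  have [t1' tt1 h1] := tri _ _ m00 xt.
  have [t2' tt2 h2] := tri _ _ m10 yt.
  pose t' := Num.min t1' t2'.
  have tt' : t < t' by rewrite lt_min tt1.
  have t'0 : 0 < t' := lt_trans t0 tt'.
  have := @H x y (t' * m0) (t' * m1) (mulr_gt0 t'0 m00) (mulr_gt0 t'0 m10).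
  rewrite pmeanZ ?(ltW t'0) ?(ltW m00) ?(ltW m10)// -/M => hh.
  apply: lt_le_trans (hh _ _).
  - by rewrite lte_fin ltr_pM2r.
  - by apply: le_lt_trans h1; rewrite lee_fin ler_pM2r// ge_min lexx.
  - by apply: le_lt_trans h2; rewrite lee_fin ler_pM2r// ge_min lexx orbT.
have G0E := layer_cake m00 mf0 f00; have G1E := layer_cake m10 mf1 f10.
have GE := layer_cake M0 mf fge0.
apply: (@le_trans _ _ (\int[mu]_x mine (f x) M%:E)%E); last first.
  apply: le_lower_integral => x _; last by rewrite ge_min lexx.
  by rewrite le_min fge0 lee_fin ltW.
have am' : ((a / m0)%:E <= \int[mu]_(t in `]0%R, 1%R[) G0 t)%E.
  rewrite mulrC EFinM lee_pdivrMl// -G0E; exact: ltW.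
have bm' : ((b / m1)%:E <= \int[mu]_(t in `]0%R, 1%R[) G1 t)%E.
  rewrite mulrC EFinM lee_pdivrMl// -G1E; exact: ltW.
rewrite GE.
have key : (((1 - l) * (a / m0) + l * (b / m1))%:E <=
    \int[mu]_(t in `]0%R, 1%R[) G t)%E.
  apply: (@le_trans _ _ (\int[mu]_(t in `]0%R, 1%R[)
      ((1 - l)%:E * G0 t + l%:E * G1 t))%E).
    rewrite ge0_integralD//; last 4 first.
    - by move=> t _; rewrite mule_ge0// lee_fin ltW.
    - exact: measurable_funeM.
    - by move=> t _; rewrite mule_ge0// lee_fin ltW.
    - exact: measurable_funeM.
    rewrite !ge0_integralZl//; try by rewrite lee_fin ltW.
    by rewrite EFinD !EFinM leeD// lee_pmul2l ?lte_fin.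
  apply: le_lower_integral => t /=; rewrite in_itv/= => t01; last exact: bm01.
  by rewrite adde_ge0// mule_ge0// lee_fin ltW.
apply: (@le_trans _ _ (M%:E * ((1 - l) * (a / m0) + l * (b / m1))%:E)%E).
  by rewrite -EFinM lee_fin pmean_hoelder// ltW.
by rewrite lee_pmul2l ?lte_fin.
Qed.

(* [a < F0 x] and [b < F1 y] stand for the values themselves, which may be infinite. *)
Definition bbl (V : lmodType R) r l (F0 F1 F : V -> \bar R) :=
  forall x y a b, 0 < a -> 0 < b -> (a%:E < F0 x)%E -> (b%:E < F1 y)%E ->
  ((pmean r l a b)%:E <= F ((1 - l) *: x + l *: y)%R)%E.

Definition pconcave (V : lmodType R) r (F : V -> \bar R) :=
  forall l, 0 < l < 1 -> bbl r l F F F.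

Lemma pconcave_interval r (f : R -> \bar R) : 0 < r ->
  (forall x, 0 <= f x)%E -> pconcave r (f : R^o -> _) ->
  forall c : R, is_interval [set x | (c%:E < f x)%E].
Proof.
move=> r0 f0 fc c x y /= cx cy z /andP[xz zy].
have [c0|c0] := ltP c 0; first by rewrite (lt_le_trans _ (f0 z))// lte_fin.
have [<-//|xz'] := eqVneq x z; have [<-//|zy'] := eqVneq y z.
have xz2 : x < z by rewrite lt_neqAle xz'.
have zy2 : z < y by rewrite lt_neqAle eq_sym zy'.
(* A level strictly above [c] is positive, as [bbl] demands, and turns its weak conclusion into a
   strict one at [c]; the mean of [c'] and [c'] is [c']. *)
have [c' [cc' cx' cy']] : exists c', [/\ c < c', (c'%:E < f x)%E & (c'%:E < f y)%E].
  have : (c%:E < mine (f x) (f y))%E by rewrite lt_min cx.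
  have E c' : (c'%:E < mine (f x) (f y) -> (c'%:E < f x) /\ (c'%:E < f y))%E.
    by rewrite lt_min => /andP[].
  case: (mine _ _) E => [m| |//] E; rewrite ?lte_fin => cm.
    have [|] := E ((c + m) / 2); first by rewrite lte_fin; lra.
    by exists ((c + m) / 2); split => //; lra.
  have [|] := E (c + 1); first by rewrite ltry.
  by exists (c + 1); split => //; lra.
pose l := (z - x) / (y - x).
have yx0 : 0 < y - x by rewrite subr_gt0 (lt_trans xz2).
have l01 : 0 < l < 1.
  apply/andP; split; first by apply: divr_gt0 => //; rewrite subr_gt0.
  by rewrite /l ltr_pdivrMr// mul1r ltrD2r.
have c'0 : 0 < c' by exact: le_lt_trans cc'.
have := @fc l l01 x y c' c' c'0 c'0 cx' cy'.
rewrite pmean_id ?(ltW c'0)//.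
have -> : (1 - l) *: (x : R^o) + l *: (y : R^o) = z.
  rewrite /GRing.scale/= /l; field; exact: lt0r_neq0.
by apply: lt_le_trans; rewrite lte_fin.
Qed.

(** Superlevel sets are intervals, hence Borel. Applied to marginals, this is the source of
    measurability for all iterated integrals. *)
Lemma pconcave_measurable r (f : R -> \bar R) : 0 < r ->
  (forall x, 0 <= f x)%E -> pconcave r (f : R^o -> _) -> measurable_fun setT f.
Proof.
move=> r0 f0 fc; apply: (measurability _ (ErealGenOInfty.measurableE R)) => //.
move=> _ [_ [c ->] <-]; rewrite setTI; apply: is_interval_measurable.
have := @pconcave_interval r f r0 f0 fc c.
congr is_interval; apply/seteqP; split => x; rewrite /= in_itv/= ?andbT//.
Qed.

Definition fiber n (F : 'rV[R]_n.+1 -> \bar R) (x : R) (v : 'rV[R]_n) :=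
  F (row_mx (const_mx x : 'rV_1) v : 'rV_(1 + n)).

Lemma intRnS n (F : 'rV[R]_n.+1 -> \bar R) :
  intRn F = (\int[mu]_x intRn (fiber F x))%E.
Proof. by []. Qed.

Lemma intRn_ge0 n (F : 'rV[R]_n -> \bar R) : (forall x, 0 <= F x)%E ->
  (0 <= intRn F)%E.
Proof.
elim: n F => [|n IH] F F0; [exact: F0|rewrite intRnS]; apply: integral_ge0 => x _.
by apply: IH => v; exact: F0.
Qed.

Lemma fiber_bbl n r l (F0 F1 F : 'rV[R]_n.+1 -> \bar R) x y : bbl r l F0 F1 F ->
  bbl r l (fiber F0 x) (fiber F1 y) (fiber F ((1 - l) * x + l * y)).
Proof.
move=> H v w a b a0 b0 av bw; have := H _ _ _ _ a0 b0 av bw.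
rewrite /fiber; congr (_ <= F _)%E.
have E : (1 - l) *: (row_mx (const_mx x) v : 'rV_(1 + n)) +
    l *: (row_mx (const_mx y) w : 'rV_(1 + n)) =
    row_mx (const_mx ((1 - l) * x + l * y)) ((1 - l) *: v + l *: w).
  rewrite !scale_row_mx add_row_mx; congr row_mx.
  by apply/matrixP => i j; rewrite !mxE.
exact: E.
Qed.

Lemma fiber_pconcave n r (F : 'rV[R]_n.+1 -> \bar R) x : pconcave r F ->
  pconcave r (fiber F x).
Proof.
move=> H l l01; have := @fiber_bbl n r l F F F x x (H l l01).
by rewrite -mulrDl subrK mul1r.
Qed.

(** Induction on the dimension: the integrals over fibers satisfy the inequality with [r + n] by
    induction, and [bbl_integral] adds one more. Power concavity of each of the three functions is
    carried along to make its marginal measurable. *)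
Lemma intRn_bbl n r l (F0 F1 F : 'rV[R]_n -> \bar R) : 0 < r -> 0 < l < 1 ->
  (forall x, 0 <= F0 x)%E -> (forall x, 0 <= F1 x)%E -> (forall x, 0 <= F x)%E ->
  pconcave r F0 -> pconcave r F1 -> pconcave r F -> bbl r l F0 F1 F ->
  forall a b, 0 < a -> 0 < b -> (a%:E < intRn F0)%E -> (b%:E < intRn F1)%E ->
  ((pmean (r + n%:R) l a b)%:E <= intRn F)%E.
Proof.
move=> r0; elim: n l F0 F1 F => [|n IH] l F0 F1 F l01 F00 F10 Fge0 c0 c1 c H.
  move=> a b a0 b0 /= aF bF; rewrite addr0.
  by have := H _ _ _ _ a0 b0 aF bF; rewrite !scaler0 addr0.
have rn : 0 < r + n%:R by rewrite ltr_wpDr.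
(* The induction hypothesis for two fibers of one function says that its marginal is again power
   concave. *)
have marg (K : 'rV[R]_n.+1 -> \bar R) : (forall x, 0 <= K x)%E -> pconcave r K ->
    pconcave (r + n%:R) ((fun x => intRn (fiber K x)) : R^o -> _).
  move=> K0 cK t t01 x y a b a0 b0 aK bK.
  apply: (IH _ (fiber K x) (fiber K y)) => //; try exact: fiber_pconcave;
    try by move=> v; exact: K0.
  exact: (@fiber_bbl n r t K K K x y (cK t t01)).
have mge0 (K : 'rV[R]_n.+1 -> \bar R) : (forall x, 0 <= K x)%E ->
    forall x, (0 <= intRn (fiber K x))%E.
  by move=> K0 x; apply: intRn_ge0 => v; exact: K0.
rewrite -natr1 addrA; apply: (@bbl_integral (r + n%:R) l
  (fun x => intRn (fiber F0 x)) (fun x => intRn (fiber F1 x))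
  (fun x => intRn (fiber F x))) => //; try exact: mge0.
- by apply: (pconcave_measurable rn); [exact: mge0|exact: marg].
- by apply: (pconcave_measurable rn); [exact: mge0|exact: marg].
- by apply: (pconcave_measurable rn); [exact: mge0|exact: marg].
- by apply: (pconcave_interval rn); [exact: mge0|exact: marg].
- by apply: (pconcave_interval rn); [exact: mge0|exact: marg].
move=> x y a b a0 b0 aF bF.
apply: (IH _ (fiber F0 x) (fiber F1 y)) => //; try exact: fiber_pconcave.
- by move=> v; exact: F00.
- by move=> v; exact: F10.
- by move=> v; exact: Fge0.
exact: fiber_bbl.
Qed.

Lemma intRn_fiber_measurable n r (F : 'rV[R]_n.+1 -> \bar R) : 0 < r ->
  (forall x, 0 <= F x)%E -> pconcave r F ->
  measurable_fun setT (fun x => intRn (fiber F x)).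
Proof.
move=> r0 F0 cF; have rn : 0 < r + n%:R by rewrite ltr_wpDr.
apply: (pconcave_measurable rn); first by move=> x; apply: intRn_ge0 => v; exact: F0.
move=> t t01 x y a b a0 b0 aK bK.
apply: (@intRn_bbl n r t (fiber F x) (fiber F y)) => //; try exact: fiber_pconcave;
  try by move=> v; exact: F0.
exact: (@fiber_bbl n r t F F F x y (cF t t01)).
Qed.

Lemma intRn_translate n r (F : 'rV[R]_n -> \bar R) v : 0 < r ->
  (forall x, 0 <= F x)%E -> pconcave r F ->
  intRn (fun x => F (x + v)) = intRn F.
Proof.
move=> r0; elim: n F v => [|n IH] F v F0 cF.
  by rewrite /= add0r; congr F; apply/matrixP => i [].
pose v0 : R := v 0 0; pose v' : 'rV[R]_n := rsubmx (v : 'rV_(1 + n)).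
have vE : v = row_mx (const_mx v0) v' :> 'rV_(1 + n).
  rewrite -[LHS](@hsubmxK R 1 1 n v); congr row_mx; apply/matrixP => i j.
  by rewrite !mxE !ord1; congr (v _ _); apply/val_inj.
rewrite !intRnS.
rewrite [RHS](@ge0_integral_affine _ 1 v0)//; last 2 first.
- exact: intRn_fiber_measurable cF.
- by move=> x; apply: intRn_ge0 => w; exact: F0.
rewrite mul1e; apply: eq_integral => x _; rewrite mul1r.
rewrite -(IH (fiber F (x + v0)) v')//; last 2 first.
- by move=> w; exact: F0.
- exact: fiber_pconcave.
congr intRn; apply/funext => w; rewrite /fiber.
have E : row_mx (const_mx x : 'rV_1) w + row_mx (const_mx v0) v' =
    row_mx (const_mx (x + v0)) (w + v').
  by rewrite add_row_mx; congr row_mx; apply/matrixP => i j; rewrite !mxE.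
by rewrite -E vE.
Qed.

(** At every level of the iteration [F] is the measurable summand required by [lower_integralD]; [K]
    will contain the squared difference of [diff2f]. *)
Lemma intRnD n r (F K : 'rV[R]_n -> \bar R) : 0 < r ->
  (forall x, 0 <= F x)%E -> (forall x, 0 <= K x)%E -> pconcave r F ->
  intRn (fun x => F x + K x)%E = (intRn F + intRn K)%E.
Proof.
move=> r0; elim: n F K => [|n IH] F K F0 K0 cF //.
rewrite !intRnS -lower_integralD; last 3 first.
- exact: intRn_fiber_measurable cF.
- by move=> x; apply: intRn_ge0 => w; exact: F0.
- by move=> x; apply: intRn_ge0 => w; exact: K0.
apply: eq_integral => x _; rewrite -IH//.
- by move=> w; exact: F0.
- by move=> w; exact: K0.
exact: fiber_pconcave.
Qed.

End BBL.

(** * The covariogram *)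

Section Covariogram.
Context {R : realType} (n : nat) (s : R) (f : 'rV[R]_n -> R) (xi : 'rV[R]_n).
Hypotheses (s0 : 0 < s) (fc : s_concave s f).
Hypotheses (fy : (L2norm2 f < +oo)%E) (fn0 : L2norm2 f != 0%E).

Let f0 x : 0 <= f x. Proof. by case: fc. Qed.

Let F (t : R) (x : 'rV[R]_n) : \bar R := (f x * f (x + t *: xi))%:E.

Let F0 t x : (0 <= F t x)%E.
Proof. by rewrite lee_fin mulr_ge0. Qed.

Let r := 2 / s.
Let p := r + n%:R.

Let r0 : 0 < r. Proof. by rewrite divr_gt0. Qed.
Let p0 : 0 < p. Proof. by rewrite ltr_wpDr. Qed.

(** Since [x + t *: xi] is linear in [(x, t)], both factors can be interpolated while [t] moves from
    [t0] to [t1]; this later gives concavity in [t]. With [A], [A'], [B], [B'] the [s]-th powers of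
    the four values, it remains to bound the square of [(1-l) sqrt(AA') + l sqrt(BB')] by
    [((1-l)A + lB)((1-l)A' + lB')], a Cauchy-Schwarz inequality. *)
Lemma cov_integrand_bbl l t0 t1 : 0 < l < 1 ->
  bbl r l (F t0) (F t1) (F ((1 - l) * t0 + l * t1)).
Proof.
move=> l01 x y a b a0 b0; rewrite !lte_fin => ax by_.
have [l0 l1] := andP l01.
have l01' : 0 <= l <= 1 by rewrite (ltW l0) (ltW l1).
have pos (u v c : R) : 0 < c -> 0 <= u -> 0 <= v -> c < u * v -> 0 < u /\ 0 < v.
  move=> c0 u0 v0 cuv; have : 0 < u * v := lt_trans c0 cuv.
  rewrite !lt_neqAle u0 v0 !andbT ![0 == _]eq_sym mulf_eq0 negb_or.
  by case/andP => /andP[].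
have [fx fx'] := pos _ _ _ a0 (f0 _) (f0 _) ax.
have [fy1 fy'] := pos _ _ _ b0 (f0 _) (f0 _) by_.
set x' := x + t0 *: xi in ax fx'; set y' := y + t1 *: xi in by_ fy'.
have := fc.2 _ _ _ fx fy1 l01'; have := fc.2 _ _ _ fx' fy' l01'.
have -> : (1 - l) *: x' + l *: y' =
    (1 - l) *: x + l *: y + ((1 - l) * t0 + l * t1) *: xi.
  by rewrite /x' /y' !scalerDr !scalerA addrACA -scalerDl.
rewrite /F lee_fin.
move: ((1 - l) *: x + l *: y) (_ + _ *: xi) => z z'.
move=> H' H.
have sn0 : s != 0 by rewrite gt_eqF.
have half c : 0 <= c -> (c `^ (s / 2)) ^+ 2 = c `^ s.
  by move=> c0; rewrite -powR_mulrn ?powR_ge0// -powRrM divfK ?pnatr_eq0.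
have mono c u v : 0 < c -> 0 < u -> 0 < v -> c < u * v ->
    (c `^ (s / 2)) ^+ 2 <= u `^ s * v `^ s.
  move=> c0 u0 v0 cuv; rewrite half ?(ltW c0)// -powRM ?(ltW u0) ?(ltW v0)//.
  by rewrite ge0_ler_powR ?nnegrE ?(ltW s0) ?(ltW c0) ?mulr_ge0 ?(ltW u0) ?(ltW v0) ?(ltW cuv).
have as2 := mono _ _ _ a0 fx fx' ax.
have bs2 := mono _ _ _ b0 fy1 fy' by_.
rewrite /pmean.
have rV : r^-1 = s / 2 by rewrite /r invf_div.
rewrite rV.
have rE : r = 2 * s^-1 by [].
have Z0 := powR_ge0 (f z) s; have Z'0 := powR_ge0 (f z') s.
have -> : f z * f z' = (f z `^ s * f z' `^ s) `^ s^-1.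
  by rewrite powRM ?powR_ge0// -!powRrM divff// !powRr1.
have u0 := powR_ge0 a (s / 2); have w0 := powR_ge0 b (s / 2).
have A0 := powR_ge0 (f x) s; have A'0 := powR_ge0 (f x') s.
have B0 := powR_ge0 (f y) s; have B'0 := powR_ge0 (f y') s.
have X0 : 0 <= (1 - l) * a `^ (s / 2) + l * b `^ (s / 2).
  by rewrite addr_ge0// mulr_ge0// ?subr_ge0 ltW.
rewrite rE; set X := (1 - l) * _ + _; rewrite powRrM powR_mulrn// {}/X.
apply: ge0_ler_powR; rewrite ?nnegrE ?invr_ge0 ?(ltW s0) ?sqr_ge0 ?mulr_ge0//.
move: (f z `^ s) (f z' `^ s) Z0 Z'0 H H' => Z Z' Z0 Z'0 H H'.
move: (f x `^ s) (f x' `^ s) A0 A'0 as2 H H' => A A' A0 A'0 as2 H H'.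
move: (f y `^ s) (f y' `^ s) B0 B'0 bs2 H H' => B B' B0 B'0 bs2 H H'.
move: (a `^ (s / 2)) (b `^ (s / 2)) u0 w0 as2 bs2 {X0} => u w u0 w0 as2 bs2.
apply: (@le_trans _ _ (((1 - l) * A + l * B) * ((1 - l) * A' + l * B'))); last first.
  by apply: ler_pM => //; rewrite addr_ge0// mulr_ge0// ?subr_ge0 ltW.
(* [uw <= (AB' + A'B) / 2] by AM-GM, as [(uw)^2 <= (AB')(A'B)] *)
have uw : 2 * (u * w) <= A * B' + A' * B.
  rewrite -(@ler_pXn2r _ 2)// ?nnegrE ?addr_ge0 ?mulr_ge0//.
  apply: (@le_trans _ _ (4 * ((A * A') * (B * B')))).
    rewrite !exprMn; have -> : (2 : R) ^+ 2 = 4 by ring.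
    by rewrite ler_pM2l// ler_pM ?sqr_ge0.
  rewrite -subr_ge0 [X in 0 <= X](_ : _ = (A * B' - A' * B) ^+ 2) ?sqr_ge0//.
  ring.
have l2 : (1 - l) ^+ 2 * u ^+ 2 <= (1 - l) ^+ 2 * (A * A').
  by rewrite ler_wpM2l ?sqr_ge0.
have l3 : l ^+ 2 * w ^+ 2 <= l ^+ 2 * (B * B') by rewrite ler_wpM2l ?sqr_ge0.
have l4 : (1 - l) * l * (2 * (u * w)) <= (1 - l) * l * (A * B' + A' * B).
  by rewrite ler_wpM2l// mulr_ge0// ?subr_ge0 ltW.
lra.
Qed.

Let Fpc t : pconcave r (F t).
Proof.
move=> l l01; have := @cov_integrand_bbl l t t l01.
by rewrite -mulrDl subrK mul1r.
Qed.

Let N := fine (L2norm2 f).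

Let L2F0 : L2norm2 f = intRn (F 0).
Proof.
by congr intRn; apply/funext => x; rewrite /F scale0r addr0 expr2.
Qed.

Let NE : L2norm2 f = N%:E.
Proof.
by rewrite /N fineK// ge0_fin_numE// L2F0; apply: intRn_ge0.
Qed.

Lemma L2norm2_gt0 : 0 < N.
Proof.
rewrite lt_neqAle -lee_fin -NE L2F0 intRn_ge0// andbT eq_sym.
by apply: contra fn0 => /eqP h; rewrite NE h.
Qed.
Let N0 := L2norm2_gt0.

(** The expansion of the square, integrated with the help of translation invariance. Only sums
    appear, so nothing has to be known finite beforehand; finiteness of [covf] and [diff2f] is a
    consequence. *)
Lemma diff2f_covf t :
  (covf f xi t + (covf f xi t + diff2f f xi t) = (N + N)%:E)%E.
Proof.
have D0 x : (0 <= ((f (x + t *: xi) - f x) ^+ 2)%:E)%E by rewrite lee_fin sqr_ge0.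
have -> : covf f xi t = intRn (F t) by [].
rewrite /diff2f -(intRnD r0)// -(intRnD r0)//; last first.
  by move=> x; exact: adde_ge0.
have shift : intRn (fun x => F 0 (x + t *: xi)) = N%:E.
  by rewrite (intRn_translate _ r0)// -L2F0 NE.
transitivity (intRn (fun x => F 0 x + F 0 (x + t *: xi))%E).
  congr intRn; apply/funext => x.
  rewrite /F -!EFinD !scale0r !addr0; congr EFin; ring.
by rewrite (intRnD r0)// shift -L2F0 NE.
Qed.

Definition cov_profile (t : R) : R := fine (covf f xi t) / N.
Local Notation h := cov_profile.

Lemma covf_ge0 t : (0 <= covf f xi t)%E.
Proof. by apply: intRn_ge0 => x; exact: F0. Qed.

Let diff2f_ge0 t : (0 <= diff2f f xi t)%E.
Proof. by apply: intRn_ge0 => x; rewrite lee_fin sqr_ge0. Qed.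

Lemma covfE t : covf f xi t = (N * h t)%:E.
Proof.
have fin : covf f xi t \is a fin_num.
  rewrite ge0_fin_numE ?covf_ge0// ltNge leye_eq; apply/negP => /eqP E.
  by have := diff2f_covf t; rewrite E addye// gt_eqF// (lt_le_trans ltNy0)// adde_ge0.
by rewrite /h mulrC divfK ?gt_eqF// fineK.
Qed.

Lemma diff2fE t : diff2f f xi t = (2 * N * (1 - h t))%:E.
Proof.
have := diff2f_covf t; rewrite covfE; have := diff2f_ge0 t.
by case: (diff2f _ _ _) => [d| |]// _ [E]; congr EFin; lra.
Qed.

Lemma cov_profile_ge0 t : 0 <= h t.
Proof. by apply: divr_ge0; [exact/fine_ge0/covf_ge0|exact: ltW N0]. Qed.

Lemma cov_profile_le1 t : h t <= 1.
Proof.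
have := diff2f_ge0 t; rewrite diff2fE lee_fin pmulr_rge0 ?mulr_gt0// subr_ge0//.
Qed.

Lemma cov_profile0 : h 0 = 1.
Proof.
have -> : h 0 = N / N by rewrite /h /covf -/(F 0) -L2F0.
by rewrite divff ?gt_eqF.
Qed.

Let covf_bbl l : 0 < l < 1 -> forall t0 t1 a b : R, 0 < a -> 0 < b ->
  (a%:E < covf f xi t0)%E -> (b%:E < covf f xi t1)%E ->
  ((pmean p l a b)%:E <= covf f xi ((1 - l) * t0 + l * t1)%R)%E.
Proof.
move=> l01 t0 t1 a b a0 b0 at0 bt1.
apply: (@intRn_bbl R n r l (F t0) (F t1) (F ((1 - l) * t0 + l * t1))) => //; exact: cov_integrand_bbl.
Qed.

Lemma cov_profile_concave l x y : 0 < l < 1 -> 0 < h x -> 0 < h y ->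
  pmean p l (h x) (h y) <= h ((1 - l) * x + l * y).
Proof.
move=> l01 hx hy.
have l01' : 0 <= l <= 1 by case/andP: l01 => /ltW -> /ltW.
set z := (1 - l) * x + l * y.
have M0 : 0 < pmean p l (h x) (h y) by exact: pmean_gt0.
(* The integral inequality takes values strictly below [covf], hence the factor [t < 1]. If the
   claim failed, the [t] that brings the mean down to the midpoint between it and [h z] would
   contradict [key]. *)
suff key t : 0 < t < 1 -> t * pmean p l (h x) (h y) <= h z.
  rewrite leNgt; apply/negP => hz.
  have hz0 := cov_profile_ge0 z.
  move: M0 hz0 hz key; set M := pmean _ _ _ _; move: (h z) => H M0 hz0 hz key.
  have := key ((H + M) / (2 * M)).
  have -> : 0 < (H + M) / (2 * M) < 1.
    rewrite divr_gt0 ?mulr_gt0 ?ltr_wpDl//= ltr_pdivrMr ?mulr_gt0//; lra.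
  move=> /(_ isT); rewrite invfM mulrA divfK ?gt_eqF//; lra.
move=> /andP[t0 t1].
have tN : 0 < t * N by rewrite mulr_gt0.
have := @covf_bbl l l01 x y (t * N * h x) (t * N * h y)
  (mulr_gt0 tN hx) (mulr_gt0 tN hy).
rewrite !covfE !lte_fin !ltr_pM2r// gtr_pMl// => /(_ t1 t1).
rewrite lee_fin pmeanZ ?(ltW tN) ?(ltW hx) ?(ltW hy)// -/z.
by rewrite -mulrA mulrCA ler_pM2l.
Qed.

Lemma measurable_cov_profile : measurable_fun setT h.
Proof.
have mc : measurable_fun setT (covf f xi).
  apply: (pconcave_measurable p0 covf_ge0) => l l01 x y a b a0 b0 ax bx.
  exact: covf_bbl.
apply: measurable_funM => //; apply/measurable_EFinP.
apply: eq_measurable_fun mc => t _ /=.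
by rewrite covfE.
Qed.

End Covariogram.

(** * Elementary integrals *)

Section BasicIntegrals.
Context {R : realType}.
Local Notation mu := (@lebesgue_measure R).

(** Improper integrals of non-negative functions: the fundamental theorem on growing compact
    intervals, then monotone convergence. *)
Lemma ge0_FTC_exhaust (f F : R -> R) (D : set R) (a b : nat -> R) (l : R) :
  (forall n, a n < b n) ->
  (forall m n, (m <= n)%N -> a n <= a m) ->
  (forall m n, (m <= n)%N -> b m <= b n) ->
  D = \bigcup_n `[a n, b n]%classic ->
  (forall x, D x -> 0 <= f x) ->
  (forall x, D x -> is_derive x (1 : R) F (f x)) ->
  (forall x, D x -> {for x, continuous f}) ->
  (F (b n) - F (a n)) @[n --> \oo] --> l ->
  (\int[mu]_(x in D) (f x)%:E = l%:E)%E.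
Proof.
move=> ab da ib DE f0 dF cf Fl.
have inD n x : `[a n, b n]%classic x -> D x by rewrite DE => h; exists n.
have cw n : {within `[a n, b n], continuous f}.
  apply: continuous_in_subspaceT => x; rewrite inE => /inD; exact: cf.
have E n : (\int[mu]_(x in `[a n, b n]) (f x)%:E = (F (b n) - F (a n))%:E)%E.
  rewrite EFinB; apply: continuous_FTC2 => //.
    have cF x : D x -> {for x, continuous F}.
      by move=> /dF dFx; apply/differentiable_continuous/derivable1_diffP.
    split => [x|  |].
    - by move/subset_itv_oo_cc => /inD /dF[].
    - apply: cvg_at_right_filter; apply: cF; apply: (inD n).
      by rewrite /= in_itv/= lexx ltW.
    - apply: cvg_at_left_filter; apply: cF; apply: (inD n).
      by rewrite /= in_itv/= lexx ltW.
  by move=> x /subset_itv_oo_cc /inD /dF dFx; rewrite derive1E derive_val.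
have nd : nondecreasing_seq (fun n => `[a n, b n]%classic).
  move=> m n mn; apply/subsetPset => x /=; rewrite !in_itv/= => /andP[ax xb].
  by rewrite (le_trans (da _ _ mn) ax) (le_trans xb (ib _ _ mn)).
have := @ge0_nondecreasing_set_cvg_integral _ (measurableTypeR R) R (fun n => `[a n, b n]%classic)
  (EFin \o f) mu nd (fun n => measurable_itv _).
rewrite -DE => /(_ _ _)/= H.
have {}H : (fun n => \int[mu]_(x in `[a n, b n]) (f x)%:E)%E @ \oo -->
    (\int[mu]_(x in D) (f x)%:E)%E.
  apply: H => n; last by move=> x /inD /f0 fx; rewrite lee_fin.
  apply/measurable_EFinP; apply: subspace_continuous_measurable_fun => //.
have H2 : (fun n => \int[mu]_(x in `[a n, b n]) (f x)%:E)%E @ \oo --> l%:E.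
  by under eq_fun do rewrite E; apply: cvg_EFin => //; exact: nearW.
exact: (cvg_unique _ H H2).
Qed.

Lemma cvg_harmonic_powR (c e : R) : 0 < c -> 0 < e ->
  (c / n.+2%:R) `^ e @[n --> \oo] --> 0.
Proof.
move=> c0 e0.
apply: ((cvg_at_rightP _ _ _).1 (powR_cvg0 e0) (fun n => c / n.+2%:R)).
split; first by move=> n; rewrite divr_gt0.
rewrite -(mulr0 c); apply: cvgMr.
have := @cvg_harmonic R; rewrite -(cvg_shiftn 1).
by under eq_fun do rewrite /= addn1.
Qed.

Lemma continuous_powR_pos (a x : R) : 0 < x -> {for x, continuous (@powR R ^~ a)}.
Proof.
move=> x0; apply/differentiable_continuous/derivable1_diffP.
by apply: derivable_powR; rewrite in_itv/= x0.
Qed.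

Let is_derive_powR_div (a x : R) : a != 0 -> 0 < x ->
  is_derive x (1 : R) (fun t => t `^ a / a) (x `^ (a - 1)).
Proof.
move=> a0 x0; have h := is_derive1_powR a x0.
have -> : (fun t => t `^ a / a) = a^-1 \*: (@powR R ^~ a).
  by apply/funext => t /=; rewrite mulrC.
by apply: is_derive_eq; rewrite /GRing.scale/= mulrA mulVf// mul1r.
Qed.

Lemma integral_powR0 (a u : R) : 0 < a -> 0 < u ->
  (\int[mu]_(t in `]0%R, u[) (t `^ (a - 1))%:E = (u `^ a / a)%:E)%E.
Proof.
move=> a0 u0; rewrite (@integral_itv_bndo_bndc _ (BRight 0) u); last first.
  by apply/measurable_EFinP; exact: measurable_funTS.
(* The divisor starts at [2] because the endpoints must already be distinct for [n = 0]. *)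
apply: (@ge0_FTC_exhaust _ (fun t => t `^ a / a) _ (fun n => u / n.+2%:R) (fun=> u)).
- by move=> n; rewrite ltr_pdivrMr// ltr_pMr// ltr1n.
- by move=> m n mn; rewrite ler_pM2l// lef_pV2 ?posrE// ler_nat.
- by [].
- apply/seteqP; split => x /=; rewrite in_itv/=.
    move=> /andP[x0 xu]; exists (Num.bound (u / x)) => //=; rewrite in_itv/= xu andbT.
    rewrite ler_pdivrMr// mulrC -ler_pdivrMr// ltW//.
    rewrite (lt_le_trans (archi_boundP _))// ?ler_nat ?ltnS//; last exact: leqW.
    by rewrite divr_ge0 ?ltW.
  move=> [n _]; rewrite /= in_itv/= => /andP[ux ->]; rewrite andbT.
  by rewrite (lt_le_trans _ ux)// divr_gt0.
- by move=> x _; exact: powR_ge0.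
- move=> x /=; rewrite in_itv/= => /andP[x0 _]; apply: is_derive_powR_div => //.
  by rewrite gt_eqF.
- by move=> x /=; rewrite in_itv/= => /andP[x0 _]; exact: continuous_powR_pos.
rewrite -[X in _ --> X]subr0; apply: cvgB; first exact: cvg_cst.
by rewrite -(mul0r a^-1); apply: cvgMl; exact: cvg_harmonic_powR.
Qed.

Lemma integral_powRy (a u : R) : a < 0 -> 0 < u ->
  (\int[mu]_(t in `[u, +oo[) (t `^ (a - 1))%:E = (u `^ a / - a)%:E)%E.
Proof.
move=> a0 u0.
apply: (@ge0_FTC_exhaust _ (fun t => t `^ a / a) _ (fun=> u) (fun n => u * n.+2%:R)).
- by move=> n; rewrite ltr_pMr// ltr1n.
- by [].
- by move=> m n mn; rewrite ler_pM2l// ler_nat.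
- apply/seteqP; split => x /=; rewrite in_itv/= ?andbT.
    move=> ux; exists (Num.bound (x / u)) => //=; rewrite in_itv/= ux/=.
    rewrite -ler_pdivrMl// mulrC ltW//.
    rewrite (lt_le_trans (archi_boundP _))// ?ler_nat ?ltnS//; last exact: leqW.
    by rewrite divr_ge0 ?ltW// (lt_le_trans u0).
  by move=> [n _]; rewrite /= in_itv/= => /andP[ux _].
- by move=> x _; exact: powR_ge0.
- move=> x /=; rewrite in_itv/= andbT => ux; apply: is_derive_powR_div.
    by rewrite lt_eqF.
  exact: lt_le_trans ux.
- move=> x /=; rewrite in_itv/= andbT => ux; apply: continuous_powR_pos.
  exact: lt_le_trans ux.
have -> : u `^ a / - a = 0 - u `^ a / a by rewrite invrN mulrN sub0r.
apply: cvgB; last exact: cvg_cst.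
rewrite -(mul0r a^-1); apply: cvgMl.
have := @cvg_harmonic_powR u^-1 (- a); rewrite invr_gt0 oppr_gt0 => /(_ u0 a0).
apply: cvg_trans; apply: near_eq_cvg; apply: nearW => n /=.
rewrite powRN -invfM.
have w0 : 0 <= u * n.+2%:R by rewrite mulr_ge0// ltW.
by rewrite -(powR_inv1 w0) -powRrM mulN1r powRN invrK.
Qed.

Lemma integral_inv_itv (u v : R) : 0 < u -> u <= v ->
  (\int[mu]_(t in `[u, v[) (t^-1)%:E = (ln v - ln u)%:E)%E.
Proof.
move=> u0; rewrite le_eqVlt => /predU1P[<-|uv].
  by rewrite subrr set_itvco0// integral_set0.
have cV x : 0 < x -> {for x, continuous (@GRing.inv R)}.
  by move=> x0; apply: inv_continuous; rewrite gt_eqF.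
rewrite (@integral_itv_bndo_bndc _ (BLeft u) v); last first.
  apply/measurable_EFinP; apply: subspace_continuous_measurable_fun => //.
  apply: continuous_in_subspaceT => x; rewrite inE/= in_itv/= => /andP[ux _].
  by apply: cV; exact: lt_le_trans ux.
apply: (@ge0_FTC_exhaust _ (@ln R) _ (fun=> u) (fun=> v)) => //.
- by apply/seteqP; split => x //=; [exists 0%N|case].
- move=> x /=; rewrite in_itv/= => /andP[ux _].
  by rewrite invr_ge0 (le_trans (ltW u0)).
- move=> x /=; rewrite in_itv/= => /andP[ux _].
  by apply: is_derive1_ln; exact: lt_le_trans ux.
- move=> x /=; rewrite in_itv/= => /andP[ux _].
  by apply: cV; exact: lt_le_trans ux.
exact: cvg_cst.
Qed.

Lemma integral_onem_powR (p x : R) : 0 < p -> x < 1 ->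
  (\int[mu]_(t in `[x, 1%R[) (p * (1 - t) `^ (p - 1))%:E = ((1 - x) `^ p)%:E)%E.
Proof.
move=> p0 x1; have x1' : 0 < 1 - x by rewrite subr_gt0.
apply: (@ge0_FTC_exhaust _ (fun t => - (1 - t) `^ p) _ (fun=> x)
  (fun n => 1 - (1 - x) / n.+2%:R)).
- by move=> n; rewrite ltrBrDl -ltrBrDr ltr_pdivrMr// ltr_pMr// ltr1n.
- by [].
- by move=> m n mn; rewrite lerD2l lerN2 ler_pM2l// lef_pV2 ?posrE// ler_nat.
- apply/seteqP; split => t /=; rewrite in_itv/=.
    move=> /andP[xt t1]; have t1' : 0 < 1 - t by rewrite subr_gt0.
    exists (Num.bound ((1 - x) / (1 - t))) => //=; rewrite in_itv/= xt/=.
    rewrite lerBrDl -lerBrDr ler_pdivrMr// mulrC -ler_pdivrMr// ltW//.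
    rewrite (lt_le_trans (archi_boundP _))// ?ler_nat ?ltnS//; last exact: leqW.
    by rewrite divr_ge0 ?ltW.
  move=> [n _]; rewrite /= in_itv/= => /andP[-> /le_lt_trans]; apply.
  by rewrite ltrBlDr ltrDl divr_gt0.
- by move=> t _; rewrite mulr_ge0 ?powR_ge0// ltW.
- move=> t /=; rewrite in_itv/= => /andP[_ t1].
  have t1' : 0 < 1 - t by rewrite subr_gt0.
  have h : is_derive (1 - t) (1 : R) (@powR R ^~ p) (p * (1 - t) `^ (p - 1)).
    exact: is_derive1_powR.
  have h2 : is_derive t (1 : R) (fun t => 1 - t) (-1).
    have -> : (fun t : R => 1 - t) = cst 1 - id by [].
    by apply: is_derive_eq; rewrite sub0r.
  have := @is_derive1_comp _ (@powR R ^~ p) (fun t => 1 - t) t _ _ h h2.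
  move=> h3; apply: is_derive_eq; rewrite -scaleN1r /GRing.scale/=; ring.
- move=> t /=; rewrite in_itv/= => /andP[_ t1].
  have t1' : 0 < 1 - t by rewrite subr_gt0.
  have h1 : (1 - u : R) @[u --> t] --> 1 - t.
    by apply: cvgB; [exact: cvg_cst|exact: cvg_id].
  have h2 : (1 - u) `^ (p - 1) @[u --> t] --> (1 - t) `^ (p - 1).
    exact: (cvg_comp _ _ h1 (@continuous_powR_pos (p - 1) _ t1')).
  exact: (cvgM (cvg_cst p) h2).
rewrite -[X in _ --> X](add0r) -{1}oppr0.
under eq_fun do rewrite opprK subKr.
exact: (cvgD (cvgN (cvg_harmonic_powR x1' p0)) (cvg_cst _)).
Qed.

End BasicIntegrals.

(** * Regularized Mellin moments and the crossing argument *)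

Section Moments.
Context {R : realType}.
Local Notation mu := (@lebesgue_measure R).
Local Notation pos := (`]0%R, +oo[%classic : set R).

Lemma integrable_power_bound (g : R -> R) (K c e : R) :
  measurable_fun pos g -> -1 < c -> e < -1 -> 0 <= K ->
  (forall t, 0 < t -> t < 1 -> `|g t| <= K * t `^ c) ->
  (forall t, 1 <= t -> `|g t| <= K * t `^ e) ->
  mu.-integrable pos (EFin \o g).
Proof.
move=> mg c1 e1 K0 gc ge_; apply/integrableP; split; first exact/measurable_EFinP.
have posE : pos = `]0%R, 1%R[%classic `|` `[1%R, +oo[%classic.
  by rewrite -itv_bndbnd_setU// bnd_simp.
have mng : measurable_fun pos (fun t => `|(EFin \o g) t|%E).
  by apply: measurableT_comp => //; exact/measurable_EFinP.
rewrite posE ge0_integral_setU//=; last 2 first.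
- by rewrite -posE.
- apply/disj_setPS => t /= [].
  by rewrite !in_itv/= => /andP[_ t1] /andP[+ _]; rewrite leNgt t1.
have powm k : measurable_fun setT (fun t : R => (t `^ k)%:E).
  by apply/measurable_EFinP; exact: measurable_powR.
apply: lte_add_pinfty.
  apply: (@le_lt_trans _ _ (\int[mu]_(t in `]0%R, 1%R[) (K%:E * (t `^ c)%:E))%E).
    apply: le_lower_integral => t //=; rewrite in_itv/= => /andP[t0 t1].
    by rewrite -EFinM lee_fin gc.
  rewrite ge0_integralZl//; last 2 first.
  - exact: (measurable_funTS (powm c)).
  - by move=> t _; rewrite lee_fin powR_ge0.
  have := @integral_powR0 R (c + 1) 1; rewrite addrK => -> //; last by lra.
  by rewrite -EFinM ltry.
apply: (@le_lt_trans _ _ (\int[mu]_(t in `[1%R, +oo[) (K%:E * (t `^ e)%:E))%E).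
  apply: le_lower_integral => t //=; rewrite in_itv/= andbT => t1.
  by rewrite -EFinM lee_fin ge_.
rewrite ge0_integralZl//; last 2 first.
- exact: (measurable_funTS (powm e)).
- by move=> t _; rewrite lee_fin powR_ge0.
have := @integral_powRy R (e + 1) 1; rewrite addrK => -> //; last by lra.
by rewrite -EFinM ltry.
Qed.

(* Subtracting [wref a] regularizes the Mellin transform of a profile equal to 1 at 0
   and with bounded support, so that it converges for every [a > -1]. *)
Definition wref (a t : R) : R :=
  if 0 < a then 0 else if a < 0 then 1 else if t < 1 then 1 else 0.

Definition phi (a : R) (h : R -> R) : R :=
  (\int[mu]_(t in pos) (t `^ (a - 1) * (h t - wref a t)))%R.

(** The linear bound makes [t^(a-1) * (1 - h t)] at most of order [t^a] near [0], integrable for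
    [a > -1]; bounded support takes care of infinity. *)
Definition nice (h : R -> R) : Prop :=
  [/\ measurable_fun setT h, forall t, 0 < t -> 0 <= h t <= 1,
      exists C, forall t, 0 < t -> 1 - C * t <= h t &
      exists T, forall t, T <= t -> h t = 0].

Lemma measurable_wref a : measurable_fun setT (wref a).
Proof.
have -> : wref a = if 0 < a then cst 0 else if a < 0 then cst 1
    else \1_(`]-oo, 1%R[%classic : set R).
  apply/funext => t; rewrite /wref; case: ifP => // _; case: ifP => // _.
  rewrite indicE; case: ifPn => t1; first by rewrite mem_set//= in_itv.
  by rewrite memNset//= in_itv/=; exact/negP.
case: ifP => _; first exact: measurable_cst.
by case: ifP => _; [exact: measurable_cst|exact: measurable_indic].
Qed.

Lemma nice_integrable h a : nice h -> -1 < a ->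
  mu.-integrable pos (EFin \o (fun t => t `^ (a - 1) * (h t - wref a t))).
Proof.
move=> [mh h01 [C hC] [T hT]] a1.
pose K := 1 + `|C| + `|T| `^ (a + 1).
have K0 : 0 <= K by rewrite !addr_ge0// powR_ge0.
have KC : `|C| <= K by rewrite /K addrAC lerDr addr_ge0// powR_ge0.
have KT : `|T| `^ (a + 1) <= K by rewrite /K lerDr addr_ge0.
have K1 : 1 <= K by rewrite /K -addrA lerDl addr_ge0// powR_ge0.
(* On the support [t <= T], so in [t^(a-1) = t^(a+1) * t^(-2)] the first factor is at most
   [|T|^(a+1)]. *)
have big t : 1 <= t -> t `^ (a - 1) * h t <= K * t `^ (- 2).
  move=> t1; have t0 : 0 < t by lra.
  have [tT|Tt] := leP T t; first by rewrite hT// mulr0 mulr_ge0 ?powR_ge0.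
  have -> : a - 1 = (a + 1) + (- 2) by ring.
  rewrite powRD; last by rewrite (gt_eqF t0) implybT.
  have /andP[h0 h1] := h01 _ t0.
  rewrite mulrAC ler_wpM2r ?powR_ge0//; apply: le_trans KT.
  apply: (@le_trans _ _ (t `^ (a + 1))); first by rewrite ler_piMr ?powR_ge0.
  rewrite ge0_ler_powR ?nnegrE//; [lra|lra|].
  by rewrite (le_trans (ltW Tt))// ler_norm.
have small t : 0 < t -> t `^ (a - 1) * (1 - h t) <= K * t `^ a.
  move=> t0; rewrite powRB; last by rewrite (gt_eqF t0) implybT.
  rewrite powRr1 ?(ltW t0)// mulrAC -mulrA mulrC ler_wpM2r ?powR_ge0//.
  rewrite ler_pdivrMr//; apply: le_trans (_ : C * t <= _); first by have := hC t t0; lra.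
  rewrite ler_wpM2r ?(ltW t0)//; exact: le_trans (ler_norm _) KC.
apply: (@integrable_power_bound _ K (if 0 < a then a - 1 else a)
  (if a < 0 then a - 1 else - 2)) => //.
- apply: measurable_funTS; apply: measurable_funM; first exact: measurable_powR.
  by apply: measurable_funB => //; exact: measurable_wref.
- by case: ifPn => // a0; lra.
- by case: ifPn => // a0; lra.
- move=> t t0 t1; rewrite /wref; have /andP[h0 h1] := h01 _ t0.
  case: ifPn => a0.
    rewrite subr0 ger0_norm ?mulr_ge0 ?powR_ge0// mulrC ler_wpM2r ?powR_ge0//.
    exact: le_trans K1.
  have -> : (if a < 0 then 1 else if t < 1 then 1 else 0) = 1 :> R by rewrite t1 if_same.
  rewrite -[h t - 1]opprB mulrN normrN ger0_norm ?small// mulr_ge0 ?powR_ge0// subr_ge0//.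
move=> t t1; have t0 : 0 < t by lra.
rewrite /wref; have /andP[h0 h1] := h01 _ t0.
have [a0|a0|a0] := ltrgtP 0 a.
- by rewrite subr0 ger0_norm ?big// mulr_ge0 ?powR_ge0.
- rewrite -[h t - 1]opprB mulrN normrN ger0_norm; last by rewrite mulr_ge0 ?powR_ge0// subr_ge0.
  rewrite mulrC ler_wpM2r ?powR_ge0//; lra.
rewrite ltNge t1/= subr0 ger0_norm ?mulr_ge0 ?powR_ge0//.
by have := big _ t1; rewrite -a0.
Qed.

Lemma phiB h h' a : nice h -> nice h' -> -1 < a ->
  phi a h - phi a h' = (\int[mu]_(t in pos) (t `^ (a - 1) * (h t - h' t)))%R.
Proof.
move=> nh nh' a1; rewrite /phi -RintegralB//; try exact: nice_integrable.
by apply: eq_Rintegral => t _; ring.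
Qed.

Lemma phiB_integrable h h' a : nice h -> nice h' -> -1 < a ->
  mu.-integrable pos (EFin \o (fun t => t `^ (a - 1) * (h t - h' t))).
Proof.
move=> nh nh' a1.
have := @integrableB _ _ R mu pos _ _ _ (nice_integrable nh a1) (nice_integrable nh' a1).
move=> /(_ (measurable_itv _)); apply: eq_integrable => // t _.
by rewrite /= -EFinB; congr EFin; ring.
Qed.

Lemma le_phi h h' a : nice h -> nice h' -> -1 < a ->
  (forall t, 0 < t -> h t <= h' t) -> phi a h <= phi a h'.
Proof.
move=> nh nh' a1 hh'; apply: le_Rintegral => //; try exact: nice_integrable.
move=> t; rewrite /= in_itv/= andbT => t0.
by rewrite ler_wpM2l ?powR_ge0// lerB// hh'.
Qed.

(** The factors [t^(b-a) - t0^(b-a)] and [h t - h' t] have opposite signs on both sides of [t0].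
    Integrating their product against [t^(a-1)] gives the claim, because the term with [t0^(b-a)]
    vanishes by the equality at [a]. *)
Lemma phi_crossing h h' t0 a b : nice h -> nice h' -> -1 < a -> a < b ->
  0 <= t0 -> (forall t, 0 < t -> t < t0 -> h' t <= h t) ->
  (forall t, 0 < t -> t0 < t -> h t <= h' t) ->
  phi a h = phi a h' -> phi b h <= phi b h'.
Proof.
move=> nh nh' a1 ab t00 lo hi E.
have b1 : -1 < b by lra.
rewrite -subr_le0 phiB//.
have z : (\int[mu]_(t in pos) (t0 `^ (b - a) * (t `^ (a - 1) * (h t - h' t))))%R = 0.
  by rewrite RintegralZl//; [rewrite -phiB// E subrr mulr0|exact: phiB_integrable].
rewrite -[leRHS]z; apply: le_Rintegral => //; first exact: phiB_integrable.
  have := @integrableZl _ _ R mu pos (measurable_itv _) (t0 `^ (b - a)) _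
    (phiB_integrable nh nh' a1).
  by apply: eq_integrable => // t _; rewrite /= EFinM.
move=> t; rewrite /= in_itv/= andbT => tp.
have -> : b - 1 = (b - a) + (a - 1) by ring.
rewrite powRD; last by rewrite (gt_eqF tp) implybT.
rewrite -mulrA -subr_ge0 -mulrBl.
have ba : 0 <= b - a by lra.
have [tt0|tt0|->] := ltrgtP t t0; last by rewrite subrr mul0r.
  rewrite mulr_ge0 ?subr_ge0 ?ge0_ler_powR ?nnegrE ?(ltW tp) ?(ltW tt0)//.
  by rewrite mulr_ge0 ?powR_ge0// subr_ge0 lo.
rewrite mulr_le0 ?subr_le0 ?ge0_ler_powR ?nnegrE ?(ltW tp) ?(ltW tt0)//.
by rewrite mulr_ge0_le0 ?powR_ge0// subr_le0 hi.
Qed.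

Lemma Rintegral_scale (c : R) (f : R -> R) : 0 < c -> measurable_fun pos f ->
  (\int[mu]_(t in pos) f t)%R = c * (\int[mu]_(t in pos) f (c * t))%R.
Proof.
move=> c0 mf.
have E : (\int[mu]_(t in pos) (f t)%:E = c%:E * \int[mu]_(t in pos) (f (c * t)%R)%:E)%E.
  rewrite integral_mkcond [in RHS]integral_mkcond.
  set g := (fun t => (f t)%:E) \_ pos.
  have mg : measurable_fun setT g.
    by apply/(measurable_restrictT _ _).1 => //; exact/measurable_EFinP.
  have -> : (fun t => (f (c * t))%:E) \_ pos = fun t => g (c * t + 0).
    apply/funext => t; rewrite /g addr0 /patch.
    have -> // : (t \in pos) = (c * t \in pos).
    by apply/idP/idP; rewrite !inE/= !in_itv/= !andbT pmulr_rgt0.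
  rewrite integralE [in RHS]integralE.
  rewrite (@ge0_integral_affine _ c 0 (g^\+)%E)//; last exact: measurable_funepos.
  rewrite (@ge0_integral_affine _ c 0 (g^\-)%E)//; last exact: measurable_funeneg.
  have cy : (c%:E * +oo = +oo)%E by rewrite gt0_muley ?lte_fin.
  have cNy : (c%:E * -oo = -oo)%E by rewrite gt0_muleNy ?lte_fin.
  have aux A B : (c%:E * A - c%:E * B = c%:E * (A - B))%E.
    case: A => [x| |]; case: B => [y| |]; rewrite ?cy ?cNy//.
    by change ((c * x - c * y)%:E = (c * (x - y))%:E); rewrite mulrBr.
  rewrite aux; congr (_ * _)%E; congr (_ - _)%E.
    by apply: eq_integral => x _; rewrite !funeposE.
  by apply: eq_integral => x _; rewrite !funenegE.
(* If the integral is infinite, [fine] makes both sides [0]. *)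
rewrite /Rintegral E; case: (\int[mu]_(t in pos) _)%E => [x| |] //=.
  by rewrite gt0_muley ?lte_fin// mulr0.
by rewrite gt0_muleNy ?lte_fin// mulr0.
Qed.

End Moments.

(** * The extremal profile *)

Section Model.
Context {R : realType}.
Local Notation mu := (@lebesgue_measure R).
Local Notation pos := (`]0%R, +oo[%classic : set R).

Lemma bernoulli_expr (x : R) k : x <= 1 -> 1 - k%:R * x <= (1 - x) ^+ k.
Proof.
move=> x1; elim: k => [|k IH]; first by rewrite mul0r subr0 expr0.
rewrite exprSr; apply: (@le_trans _ _ ((1 - k%:R * x) * (1 - x))).
  have := mulr_ge0 (ler0n R k) (sqr_ge0 x); rewrite -natr1; lra.
by rewrite ler_wpM2r// subr_ge0.
Qed.

(** With [m] an integer above [p], [(1-x)^p >= (1-x)^m] on [[0, 1]], and Bernoulli applies to [m].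
    The slope [p] itself would fail for [p < 1]. *)
Lemma bernoulli_powR (p : R) : 0 < p ->
  exists2 m : R, 1 <= m & forall x, 0 <= x <= 1 -> 1 - m * x <= (1 - x) `^ p.
Proof.
move=> p0; pose m := Num.bound p.
have pm : p < m%:R by rewrite archi_boundP// ltW.
have m1 : (0 < m)%N by rewrite -(@ltr0n R) (lt_trans p0).
have m1' : 1 <= m%:R :> R by rewrite ler1n.
exists m%:R => // x /andP[x0 x1].
have [->|x1'] := eqVneq x 1; first by rewrite subrr powR0 ?gt_eqF//; lra.
apply: (le_trans (bernoulli_expr m x1)); rewrite -powR_mulrn ?subr_ge0//.
apply: ger_powR; last exact: ltW.
by rewrite subr_gt0 lt_neqAle x1' x1/= gerBl.
Qed.

Definition model (p c t : R) : R := (Num.max 0 (1 - t / c)) `^ p.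

(** A profile with explicit [phi]: [u^a / a], or [ln u] at index [0]. Comparison with it yields the
    sign of [a * phi a h], the scaling law at [0] and the expansion near [0]. *)
Definition step (u t : R) : R := if t < u then 1 else 0.

Lemma modelE p c t : 0 < c -> t <= c -> model p c t = (1 - t / c) `^ p.
Proof. by move=> c0 tc; rewrite /model max_r// subr_ge0 ler_pdivrMr// mul1r. Qed.

Lemma model_eq0 p c t : 0 < p -> 0 < c -> c <= t -> model p c t = 0.
Proof.
move=> p0 c0 ct; rewrite /model max_l ?powR0 ?gt_eqF//.
by rewrite subr_le0 ler_pdivlMr// mul1r.
Qed.

Lemma model_scale p c t : 0 < c -> model p c (c * t) = model p 1 t.
Proof. by move=> c0; rewrite /model divr1 [c * t]mulrC mulfK// gt_eqF. Qed.

Lemma nice_model p c : 0 < p -> 0 < c -> nice (model p c).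
Proof.
move=> p0 c0; have [m m1 bern] := bernoulli_powR p0; split.
- apply: (measurableT_comp (measurable_powR p)).
  apply: measurable_maxr => //; apply: measurable_funB => //.
  exact: measurable_funM.
- move=> t t0; rewrite powR_ge0/=.
  have [tc|ct] := leP t c; last by rewrite model_eq0 ?ltW.
  have one : 1 = 1 `^ p :> R by rewrite powR1.
    rewrite modelE// [leRHS]one ge0_ler_powR ?nnegrE ?(ltW p0)//.
    by rewrite subr_ge0 ler_pdivrMr// mul1r.
  by rewrite gerBl divr_ge0 ?ltW.
- exists (m / c) => t t0; have [tc|ct] := leP t c.
    rewrite modelE// mulrAC -mulrA; apply: bern.
    by rewrite divr_ge0 ?(ltW t0) ?(ltW c0)//= ler_pdivrMr// mul1r.
  rewrite (model_eq0 p0 c0 (ltW ct)) subr_le0 mulrAC -mulrA.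
  by rewrite (le_trans m1)// ler_peMr ?ler_pdivlMr ?mul1r ?(ltW ct)//; lra.
by exists c => t; exact: model_eq0.
Qed.

Lemma nice_step u : 0 < u -> nice (step u).
Proof.
move=> u0; split.
- have -> : step u = \1_(`]-oo, u[%classic : set R).
    apply/funext => t; rewrite /step indicE; case: ifPn => t1.
      by rewrite mem_set//= in_itv.
    by rewrite memNset//= in_itv/=; exact/negP.
  exact: measurable_indic.
- by move=> t _; rewrite /step; case: ifP; rewrite ?lexx ler01.
- exists u^-1 => t t0; rewrite /step; case: ifPn => tu.
    by rewrite gerBl mulr_ge0 ?invr_ge0 ?ltW.
  by rewrite subr_le0 mulrC ler_pdivlMr// mul1r leNgt.
by exists u => t; rewrite /step ltNge => ->.
Qed.

Lemma phi0_step u : 0 < u -> phi 0 (step u) = ln u.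
Proof.
move=> u0; rewrite /phi.
transitivity (\int[mu]_(t in pos) (t^-1 * (step u t - step 1 t)))%R.
  apply: eq_Rintegral => t; rewrite inE/= in_itv/= andbT => t0.
  by rewrite sub0r powR_inv1 ?ltW// /wref ltxx.
have sub a b : 0 < a -> (`[a, b[%classic : set R) `<=` pos.
  move=> a0 t /=; rewrite !in_itv/= andbT => /andP[at_ _].
  exact: lt_le_trans at_.
have [u1|u1] := leP 1 u.
  have -> : (\int[mu]_(t in pos) (t^-1 * (step u t - step 1 t)))%R =
      (\int[mu]_(t in `[1%R, u[) t^-1)%R.
    rewrite Rintegral_mkcond [RHS]Rintegral_mkcond; congr Rintegral.
    apply/funext => t; rewrite /patch; case: ifPn => tp; last first.
      by rewrite ifN//; apply: contra tp; rewrite !inE; exact: sub.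
    rewrite /step; have [t1|t1] := ltP t 1.
      rewrite (lt_le_trans t1 u1) subrr mulr0 ifN// notin_setE/= in_itv/=.
      by rewrite leNgt t1.
    rewrite subr0; case: ifPn => tu; first by rewrite mulr1 mem_set//= in_itv/= t1.
    by rewrite mulr0 ifN// notin_setE/= in_itv/= t1 (negbTE tu).
  by rewrite /Rintegral integral_inv_itv//= ln1 subr0.
have -> : (\int[mu]_(t in pos) (t^-1 * (step u t - step 1 t)))%R =
    (\int[mu]_(t in `[u, 1%R[) (-1 * t^-1))%R.
  rewrite Rintegral_mkcond [RHS]Rintegral_mkcond; congr Rintegral.
  apply/funext => t; rewrite /patch; case: ifPn => tp; last first.
    by rewrite ifN//; apply: contra tp; rewrite !inE; exact: sub.
  rewrite /step; have [tu|tu] := ltP t u.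
    rewrite (lt_trans tu u1) subrr mulr0 ifN// notin_setE/= in_itv/=.
    by rewrite leNgt tu.
  rewrite sub0r; case: ifPn => t1; first by rewrite mulrC mem_set//= in_itv/= tu.
  by rewrite oppr0 mulr0 ifN// notin_setE/= in_itv/= tu (negbTE t1).
have iE := integral_inv_itv u0 (ltW u1).
rewrite RintegralZl//; last first.
  apply/integrableP; split.
    apply/measurable_EFinP; apply: subspace_continuous_measurable_fun => //.
    apply: continuous_in_subspaceT => x; rewrite inE/= in_itv/= => /andP[ux _].
    by apply: inv_continuous; rewrite gt_eqF// (lt_le_trans u0).
  rewrite (_ : (\int[mu]_(x in _) _)%E = (\int[mu]_(t in `[u, 1%R[) (t^-1)%:E)%E).
    by rewrite iE ltry.
  apply: eq_integral => t; rewrite inE/= in_itv/= => /andP[ut _].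
  by rewrite ger0_norm// invr_ge0 (le_trans (ltW u0)).
by rewrite /Rintegral iE/= ln1 sub0r mulN1r opprK.
Qed.

Lemma phi_step u a : 0 < u -> -1 < a -> a != 0 -> phi a (step u) = u `^ a / a.
Proof.
move=> u0 a1; rewrite neq_lt => /orP[a0|a0]; rewrite /phi.
  have -> : (\int[mu]_(t in pos) (t `^ (a - 1) * (step u t - wref a t)))%R =
      (\int[mu]_(t in `[u, +oo[) (-1 * t `^ (a - 1)))%R.
    rewrite Rintegral_mkcond [RHS]Rintegral_mkcond; congr Rintegral.
    apply/funext => t; rewrite /patch.
    have -> : wref a t = 1 by rewrite /wref a0 ltNge (ltW a0).
    have [t1|t1] := leP u t.
      rewrite !mem_set//= ?in_itv/= ?andbT//; last exact: lt_le_trans t1.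
      by rewrite /step ltNge t1/= sub0r mulrC.
    rewrite [in RHS]ifN; last by rewrite notin_setE/= in_itv/= andbT leNgt t1.
    by rewrite /step t1 subrr mulr0; case: ifP.
  have iE := integral_powRy a0 u0.
  rewrite RintegralZl//; last first.
    apply/integrableP; split.
      by apply/measurable_EFinP; apply: measurable_funTS; exact: measurable_powR.
    rewrite (_ : (\int[mu]_(x in _) _)%E = (\int[mu]_(t in `[u, +oo[) (t `^ (a - 1))%:E)%E).
      by rewrite iE ltry.
    by apply: eq_integral => t _; rewrite /= ger0_norm// powR_ge0.
  by rewrite /Rintegral iE/= mulN1r invrN mulrN opprK.
have -> : (\int[mu]_(t in pos) (t `^ (a - 1) * (step u t - wref a t)))%R =
    (\int[mu]_(t in `]0%R, u[) t `^ (a - 1))%R.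
  rewrite Rintegral_mkcond [RHS]Rintegral_mkcond; congr Rintegral.
  apply/funext => t; rewrite /patch.
  have -> : wref a t = 0 by rewrite /wref a0.
  rewrite subr0 /step; have [t1|t1] := ltP t u.
    rewrite mulr1; have [t0|t0] := ltP 0 t.
      by rewrite !mem_set//= in_itv/= ?t0.
    by rewrite !memNset//= in_itv/= ltNge t0.
  rewrite mulr0 if_same memNset//= in_itv/= => /andP[_].
  by rewrite ltNge t1.
by rewrite /Rintegral integral_powR0.
Qed.

Lemma phi_scale p c a : 0 < p -> 0 < c -> -1 < a -> a != 0 ->
  phi a (model p c) = c `^ a * phi a (model p 1).
Proof.
move=> p0 c0 a1 an0; have c0' : c != 0 by rewrite gt_eqF.
rewrite /phi (Rintegral_scale c0); last first.
  apply/measurable_EFinP.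
  by have /integrableP[] := nice_integrable (nice_model p0 c0) a1.
transitivity (c * \int[mu]_(t in pos)
    (c `^ (a - 1) * (t `^ (a - 1) * (model p 1 t - wref a t))))%R.
  congr (_ * _); apply: eq_Rintegral => t; rewrite inE/= in_itv/= andbT => t0.
  rewrite powRM ?ltW// model_scale// -mulrA.
  by rewrite /wref; have [] := ltrgtP 0 a => // a0; rewrite -a0 eqxx in an0.
rewrite RintegralZl//; last first.
  exact: nice_integrable (nice_model p0 ltr01) a1.
rewrite mulrA; congr (_ * _).
by rewrite -[X in X * _]powRr1 ?ltW// -powRD ?c0' ?implybT// addrC subrK.
Qed.

(** At index [0] the reference is not scale invariant: the substitution [t -> c * t] turns [wref 0]
    into [step c^-1], and the discrepancy [phi 0 (step c^-1) = - ln c] is the logarithmic term. *)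
Lemma phi0_scale p c : 0 < p -> 0 < c ->
  phi 0 (model p c) = ln c + phi 0 (model p 1).
Proof.
move=> p0 c0; have N10 : (-1 : R) < 0 by lra.
have cV0 : 0 < c^-1 by rewrite invr_gt0.
rewrite /phi (Rintegral_scale c0); last first.
  apply/measurable_EFinP.
  by have /integrableP[] := nice_integrable (nice_model p0 c0) N10.
rewrite -RintegralZl//; last first.
  have := phiB_integrable (nice_model p0 ltr01) (nice_step cV0) N10.
  have := @integrableZl _ _ R mu pos (measurable_itv _) (c^-1) _ _.
  move=> /[apply]; apply: eq_integrable => // t; rewrite inE/= in_itv/= andbT => t0.
  rewrite -EFinM; congr EFin.
  rewrite !sub0r !powR_inv1 ?mulr_ge0 ?(ltW c0) ?(ltW t0)// model_scale//.
  rewrite invfM mulrA /wref ltxx /step; congr (_ * (_ - _)).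
  by rewrite [c * t]mulrC -ltr_pdivlMr// div1r.
transitivity (phi 0 (model p 1) - phi 0 (step c^-1)); last first.
  by rewrite phi0_step// lnV ?posrE// opprK addrC.
rewrite phiB//; [|exact: nice_model|exact: nice_step].
apply: eq_Rintegral => t; rewrite inE/= in_itv/= andbT => t0.
rewrite !sub0r !powR_inv1 ?mulr_ge0 ?(ltW c0) ?(ltW t0)// model_scale//.
rewrite invfM !mulrA divff ?gt_eqF// mul1r /wref ltxx /step; congr (_ * (_ - _)).
by rewrite [c * t]mulrC -ltr_pdivlMr// div1r.
Qed.

End Model.

(** * Concave profiles and their single crossing with the model *)

Section Profile.
Context {R : realType} (p : R) (h : R -> R).
Hypothesis p0 : 0 < p.

Definition profile := [/\ measurable_fun setT h, forall t, 0 <= h t <= 1, h 0 = 1 &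
  forall l x y, 0 < l < 1 -> 0 < h x -> 0 < h y ->
    pmean p l (h x) (h y) <= h ((1 - l) * x + l * y)].

Hypothesis hp : profile.

Lemma profile_lower t u : 0 < t -> t < u -> 0 < h u ->
  (1 - t / u + t / u * h u `^ p^-1) `^ p <= h t.
Proof.
case: hp => mh h01 h0 hc t0 tu hu.
have u0 : 0 < u := lt_trans t0 tu.
have l01 : 0 < t / u < 1 by rewrite divr_gt0//= ltr_pdivrMr// mul1r.
have h00 : 0 < h 0 by rewrite h0.
have := hc _ 0 u l01 h00 hu.
by rewrite mulr0 add0r divfK ?gt_eqF// h0 /pmean powR1 mulr1.
Qed.

(** Concavity between [0] and [t0] gives [h t >= (1 - t/t0)^p], hence the linear bound. A concave
    [h^(1/p)] that has dropped from [1] at [0] to [k < 1] at [t1] cannot stay positive beyond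
    [t1 / (1 - k)]. *)
Lemma nice_profile t0 t1 : 0 < t0 -> 0 < h t0 -> 0 < t1 -> h t1 < 1 -> nice h.
Proof.
move=> t00 ht0 t10 ht1; have [mh h01 h0 hc] := hp; split => //.
  have [m m1 bern] := bernoulli_powR p0.
  exists (m / t0) => t tp; have [tt0|tt0] := ltP t t0; last first.
    apply: le_trans (andP (h01 t)).1; rewrite subr_le0 mulrAC -mulrA.
    by rewrite (le_trans m1)// ler_peMr ?ler_pdivlMr ?mul1r//; lra.
  apply: le_trans (profile_lower tp tt0 ht0); rewrite mulrAC -mulrA.
  have q0 : 0 <= t / t0 by rewrite divr_ge0 ?ltW.
  have q1 : t / t0 <= 1 by rewrite ler_pdivrMr// mul1r ltW.
  apply: le_trans (bern (t / t0) _) _; first by rewrite q0.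
  have q2 : 0 <= t / t0 * h t0 `^ p^-1 by rewrite mulr_ge0 ?powR_ge0.
  have q3 : 0 <= 1 - t / t0 by rewrite subr_ge0.
  by apply: ge0_ler_powR; rewrite ?nnegrE ?(ltW p0) ?(addr_ge0 q3 q2) ?lerDl.
pose k := h t1 `^ p^-1.
have k0 : 0 <= k := powR_ge0 _ _.
have k1 : k < 1.
  have one : 1 = 1 `^ p^-1 :> R by rewrite powR1.
  rewrite [ltRHS]one gt0_ltr_powR ?invr_gt0 ?nnegrE//.
  by case/andP: (h01 t1).
have k1' : 0 < 1 - k by rewrite subr_gt0.
exists (t1 / (1 - k) + 1) => t Tt.
apply/eqP; rewrite eq_le (andP (h01 t)).1 andbT leNgt; apply/negP => ht.
have t1t : t1 < t.
  apply: lt_le_trans Tt; rewrite ltr_pwDr// ler_pdivlMr//.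
  by rewrite ler_piMr ?(ltW t10)// gerBl.
have tp : 0 < t := lt_trans t10 t1t.
have q1 : 0 <= 1 - t1 / t by rewrite subr_ge0 ler_pdivrMr// mul1r ltW.
have : (1 - t1 / t) `^ p <= h t1.
  apply: le_trans (profile_lower t10 t1t ht).
  have q2 : 0 <= t1 / t * h t `^ p^-1 by rewrite mulr_ge0 ?powR_ge0// divr_ge0 ?ltW.
  by apply: ge0_ler_powR; rewrite ?nnegrE ?(ltW p0) ?(addr_ge0 q1 q2) ?lerDl.
have pV0 : 0 <= p^-1 by rewrite invr_ge0 ltW.
move=> /(ge0_ler_powR pV0); rewrite !nnegrE powR_ge0 (andP (h01 t1)).1 => /(_ isT isT).
rewrite -powRrM divff ?gt_eqF// powRr1// -/k => H.
have : t * (1 - k) <= t1.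
  have := ler_wpM2l (ltW tp) H; rewrite mulrBr mulr1 mulrC divfK ?gt_eqF//; lra.
rewrite leNgt -ltr_pdivrMr// => /negP; apply.
by apply: lt_le_trans Tt; rewrite ltrDl.
Qed.

(** After taking [p]-th roots both functions start from [1], and the model is affine up to [c]. If
    [h] exceeds the model at some [t'], concavity keeps it above the model on all of [(0, t')]; so
    once below, always below, and [t0] is the infimum of the set where [h] is below. *)
Lemma profile_crossing c : 0 < c -> nice h -> exists t0, [/\ 0 <= t0,
  forall t, 0 < t -> t < t0 -> model p c t <= h t &
  forall t, 0 < t -> t0 < t -> h t <= model p c t].
Proof.
move=> c0 [_ _ _ [T hT]]; have [mh h01 h0 hc] := hp.
pose S := [set t | 0 < t /\ h t < model p c t].
have up t t' : S t -> t < t' -> h t' <= model p c t'.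
  move=> [t0 ht] tt'; rewrite leNgt; apply/negP => mh'.
  have t'0 : 0 < t' := lt_trans t0 tt'.
  have ht' : 0 < h t' by apply: le_lt_trans mh'; exact: powR_ge0.
  suff : model p c t <= h t by rewrite leNgt ht.
  apply: le_trans (profile_lower t0 tt' ht').
  set k := h t' `^ p^-1.
  have kk : Num.max 0 (1 - t' / c) <= k.
    have m0 : 0 <= Num.max 0 (1 - t' / c) by rewrite le_max lexx.
    have -> : Num.max 0 (1 - t' / c) = model p c t' `^ p^-1.
      by rewrite /model -powRrM divff ?gt_eqF// powRr1.
    by rewrite ge0_ler_powR ?nnegrE ?invr_ge0 ?(ltW p0) ?powR_ge0 ?(ltW ht') ?(ltW mh').
  have q0 : 0 <= t / t' by rewrite divr_ge0 ?ltW.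
  have q1 : 0 <= 1 - t / t' by rewrite subr_ge0 ler_pdivrMr// mul1r ltW.
  have k0 : 0 <= k := powR_ge0 _ _.
  have s0 : 0 <= 1 - t / t' + t / t' * k by rewrite addr_ge0// mulr_ge0.
  rewrite ge0_ler_powR ?nnegrE ?(ltW p0) ?le_max ?lexx// ge_max s0/=.
  have := ler_wpM2l q0 kk; rewrite maxr_pMr// => H.
  have : t / t' * (1 - t' / c) <= t / t' * k.
    by apply: le_trans H; rewrite le_max lexx orbT.
  have -> : t / t' * (1 - t' / c) = t / t' - t / c.
    by field; rewrite !gt_eqF.
  lra.
have [[s Ss]|S0] := pselect (exists s, S s); last first.
  (* Here [h] is never below the model, so any [t0] past the support of [h] works; [c] only makes it
     non-negative. *)
  exists (Num.max T c); split.
  - by rewrite le_max (ltW c0) orbT.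
  - move=> t t0 _; rewrite leNgt; apply/negP => ht; apply: S0; by exists t.
  - move=> t t0; rewrite gt_max => /andP[Tt ct].
    by rewrite (hT _ (ltW Tt)) powR_ge0.
have lbS : has_inf S.
  by split; [exists s|exists 0 => t [t0 _]; exact: ltW].
exists (inf S); split.
- by apply: lb_le_inf; [exists s|move=> t [t0 _]; exact: ltW].
- move=> t t0 tS; rewrite leNgt; apply/negP => ht.
  have := ge_inf lbS.2 (conj t0 ht : S t); by rewrite leNgt tS.
move=> t t0 St.
have [r Sr rt] : exists2 r, S r & r < t.
  have tS : 0 < t - inf S by rewrite subr_gt0.
  by have [r Sr rt] := inf_adherent tS lbS; exists r => //; move: rt; rewrite addrC subrK.
exact: up Sr rt.
Qed.

End Profile.

(** * Moments of the extremal profile and the Beta function *)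

Section BetaMoments.
Context {R : realType}.
Local Notation mu := (@lebesgue_measure R).
Local Notation pos := (`]0%R, +oo[%classic : set R).

Lemma tonelli_product (g w : R -> R) (A : set (R * R)) :
  measurable_fun setT g -> measurable_fun setT w -> measurable A ->
  (forall t, 0 <= g t) -> (forall u, 0 <= w u) ->
  (\int[mu]_t ((g t)%:E * \int[mu]_(u in xsection A t) (w u)%:E) =
   \int[mu]_u ((w u)%:E * \int[mu]_(t in ysection A u) (g t)%:E))%E.
Proof.
move=> mg mw mA g0 w0.
pose F (z : R * R) : \bar R := (g z.1 * w z.2 * \1_A z)%:E.
have mF : measurable_fun setT F.
  apply/measurable_EFinP; apply: measurable_funM; last exact: measurable_indic.
  by apply: measurable_funM; exact: measurableT_comp.
have F0 z : (0 <= F z)%E by rewrite lee_fin !mulr_ge0.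
have := @fubini_tonelli _ _ _ _ R mu mu F mF F0.
have -> : (\int[mu]_x \int[mu]_y F (x, y) =
    \int[mu]_t ((g t)%:E * \int[mu]_(u in xsection A t) (w u)%:E))%E.
  apply: eq_integral => t _; rewrite [in RHS]integral_mkcond -ge0_integralZl//.
  - apply: eq_integral => u _; rewrite /F/= /patch indicE -mem_xsection -mulrA EFinM.
    by case: ifP => _; rewrite ?mulr1 ?mulr0.
  - apply/(measurable_restrictT _ _).1; first exact: measurable_xsection.
    by apply/measurable_EFinP; exact: measurable_funTS.
  - by move=> u _; apply: erestrict_ge0 => v _; rewrite lee_fin.
  - by rewrite lee_fin.
move=> ->; apply: eq_integral => u _.
rewrite [in RHS]integral_mkcond -ge0_integralZl//.
- apply: eq_integral => t _; rewrite /F/= /patch indicE -mem_ysection.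
  rewrite [g t * _]mulrC -mulrA EFinM.
  by case: ifP => _; rewrite ?mulr1 ?mulr0.
- apply/(measurable_restrictT _ _).1; first exact: measurable_ysection.
  by apply/measurable_EFinP; exact: measurable_funTS.
- by move=> t _; apply: erestrict_ge0 => v _; rewrite lee_fin.
- by rewrite lee_fin.
Qed.

(** Minus the derivative of [(1 - u)^p]: a probability density on [(0, 1)] whose tail is
    [model p 1]. *)
Let wt (p u : R) : R := p * (1 - u) `^ (p - 1).

Let mwt p : measurable_fun setT (wt p).
Proof.
apply: measurable_funM => //.
apply: (measurableT_comp (measurable_powR (p - 1))).
exact: measurable_funB.
Qed.

Let integral_wt_tail p t : 0 < p -> 0 < t ->
  (\int[mu]_(u in `[t, 1%R[) (wt p u)%:E = (model p 1 t)%:E)%E.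
Proof.
move=> p0 t0; have [t1|t1] := ltP t 1.
  by rewrite integral_onem_powR// modelE ?ltW// divr1.
by rewrite set_itv_ge ?bnd_simp -?leNgt// integral_set0 model_eq0.
Qed.

Let integral_wt_head p t : 0 < p -> 0 < t ->
  (\int[mu]_(u in [set u | (0 < u < 1) && (u <= t)]%R) (wt p u)%:E =
   (1 - model p 1 t)%:E)%E.
Proof.
move=> p0 t0.
have w0 u : (0 <= (wt p u)%:E)%E by rewrite lee_fin mulr_ge0 ?powR_ge0// ltW.
have mw D : measurable_fun D (EFin \o wt p).
  by apply: measurable_funTS; apply/measurable_EFinP.
have tot : (\int[mu]_(u in `]0%R, 1%R[) (wt p u)%:E = 1)%E.
  rewrite integral_itv_obnd_cbnd//.
  by rewrite integral_onem_powR// subr0 powR1.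
have [t1|t1] := ltP t 1; last first.
  rewrite model_eq0// subr0 -tot; congr integral.
  apply/seteqP; split => u; rewrite /= in_itv/=; first by case/andP.
  by move=> u01; rewrite u01 (le_trans _ t1)//; case/andP: u01 => _ /ltW.
have setE : [set u | (0 < u < 1) && (u <= t)] = `]0%R, t]%classic.
  apply/seteqP; split => u; rewrite /= in_itv/=; first by move=> /andP[/andP[-> _]].
  by move=> /andP[-> ut]; rewrite ut andbT (le_lt_trans ut).
rewrite setE.
have U : `]0%R, 1%R[%classic = `]0%R, t]%classic `|` `]t, 1%R[%classic :> set R.
  by rewrite -itv_bndbnd_setU// bnd_simp// ltW.
have := tot; rewrite U ge0_integral_setU//=; last 2 first.
- exact: mw.
- apply/disj_setPS => u /= []; rewrite !in_itv/= => /andP[_ ut] /andP[].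
  by rewrite ltNge ut.
rewrite [X in (_ + X)%E]integral_itv_obnd_cbnd// integral_wt_tail//.
case: (\int[mu]_(u in `]0%R, t]) _)%E => [x| |]// [E].
by congr EFin; lra.
Qed.

Lemma Beta_phi (p a : R) : 0 < p -> -1 < a -> a != 0 ->
  p * Beta (a + 1) p = a * phi a (model p 1).
Proof.
move=> p0 a1 an0.
have nm := nice_model p0 (@ltr01 R).
have mpow (k : R) : measurable_fun setT (@powR R ^~ k) by exact: measurable_powR.
have w0 u : 0 <= wt p u by rewrite mulr_ge0 ?powR_ge0// ltW.
rewrite /Beta addrK.
set B := (\int[mu]_(t in _) _)%E.
have mb : measurable_fun (`]0%R, 1%R[%classic : set R) (fun t => (t `^ a * (1 - t) `^ (p - 1))%:E).
  apply: measurable_funTS; apply/measurable_EFinP; apply: measurable_funM => //.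
  by apply: (measurableT_comp (mpow (p - 1))); exact: measurable_funB.
have b0 t : (0 <= (t `^ a * (1 - t) `^ (p - 1))%:E)%E by rewrite lee_fin mulr_ge0 ?powR_ge0.
have phiE : (\int[mu]_(t in pos) (t `^ (a - 1) * (model p 1 t - wref a t))%:E)%E =
    (phi a (model p 1))%:E.
  by rewrite /phi /Rintegral fineK//; apply: integrable_fin_num => //; exact: nice_integrable.
(* both sides are [\int u^a w(u) du], Tonelli being applied to [model p 1 t = \int_t^1 w] *)
suff key : ((p / a)%:E * B = (phi a (model p 1))%:E)%E.
  (* An infinite [B] would make the left side of [key] infinite, as [p / a] is non-zero, while the
     right side is finite. *)
  move: key; case: B {phiE} => [b| |].
  - by rewrite -EFinM => -[<-] /=; field.
  - have [h|h|h] := ltrgtP (p / a) 0.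
    + by rewrite lt0_muley ?lte_fin.
    + by rewrite gt0_muley ?lte_fin.
    + by move/eqP: h; rewrite mulf_eq0 invr_eq0 (gt_eqF p0) (negbTE an0).
  - have [h|h|h] := ltrgtP (p / a) 0.
    + by rewrite lt0_muleNy ?lte_fin.
    + by rewrite gt0_muleNy ?lte_fin.
    + by move/eqP: h; rewrite mulf_eq0 invr_eq0 (gt_eqF p0) (negbTE an0).
rewrite -phiE.
(* For [a < 0] the reference is [1], so the head [1 - model p 1 t], the mass of [wt] up to [t], is
   expanded instead of the tail; the inner integral is then [u^a / (- a)]. *)
have [a0|a0] := orP (lt_total an0).
  pose A : set (R * R) := [set z | (0 < z.2 < 1) && (z.2 <= z.1)].
  have mA : measurable A.
    have -> : A = (@snd R R) @^-1` `]0%R, 1%R[%classic `&`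
        (setT `&` [set z | (z.2 <= z.1)]).
      apply/seteqP; split => z; rewrite /A/= in_itv/=; first by case/andP.
      by case=> -> [_ ->].
    apply: measurableI; last exact: measurable_fun_le.
    by rewrite -[X in measurable X]setTI; exact: measurable_snd.
  have := tonelli_product (mpow (a - 1)) (mwt p) mA
    (fun t => powR_ge0 t (a - 1)) w0.
  have -> : (\int[mu]_t ((t `^ (a - 1))%:E * \int[mu]_(u in xsection A t) (wt p u)%:E))%E =
      (\int[mu]_(t in pos) (t `^ (a - 1) * (1 - model p 1 t))%:E)%E.
    rewrite [RHS]integral_mkcond; apply: eq_integral => t _; rewrite /patch.
    case: ifPn => tp.
      have t0 : 0 < t by move: tp; rewrite inE/= in_itv/= andbT.
      rewrite (_ : xsection A t = [set u | (0 < u < 1) && (u <= t)]); last first.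
        by apply/seteqP; split => u; rewrite /xsection/= inE.
      by rewrite integral_wt_head.
    rewrite (_ : xsection A t = set0) ?integral_set0 ?mule0//.
    apply/seteqP; split => u //; rewrite /xsection/= inE /A/= => /andP[/andP[u0 _] ut].
    by move: tp; rewrite notin_setE/= in_itv/= andbT; apply; exact: lt_le_trans ut.
  have -> : (\int[mu]_u ((wt p u)%:E * \int[mu]_(t in ysection A u) (t `^ (a - 1))%:E))%E =
      ((p / - a)%:E * B)%E.
    rewrite /B -ge0_integralZl//; last first.
      by rewrite lee_fin divr_ge0 ?ltW// oppr_gt0.
    rewrite [RHS]integral_mkcond; apply: eq_integral => u _; rewrite /patch.
    case: ifPn => up.
      have /andP[u0 u1] : 0 < u < 1 by move: up; rewrite inE/= in_itv/=.
      rewrite (_ : ysection A u = `[u, +oo[%classic); last first.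
        apply/seteqP; split => t; rewrite /ysection/= inE /A/= in_itv/= ?andbT.
          by case/andP.
        by move=> ->; rewrite u0 u1.
      rewrite integral_powRy// -!EFinM; congr EFin; rewrite /wt; ring.
    rewrite (_ : ysection A u = set0) ?integral_set0 ?mule0//.
    apply/seteqP; split => t //; rewrite /ysection/= inE /A/= => /andP[u01 _].
    by move: up; rewrite notin_setE/= in_itv/= u01.
  have -> : (\int[mu]_(t in pos) (t `^ (a - 1) * (model p 1 t - wref a t))%:E =
      - \int[mu]_(t in pos) (t `^ (a - 1) * (1 - model p 1 t))%:E)%E.
    rewrite -integral_ge0N; last first.
      move=> t; rewrite /= in_itv/= andbT => t0; case: nm => _ h01 _ _.
      by rewrite lee_fin mulr_ge0 ?powR_ge0// subr_ge0; case/andP: (h01 t t0).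
    apply: eq_integral => t _; rewrite -EFinN; congr EFin.
    by rewrite /wref a0 ltNge (ltW a0)/=; ring.
  by move=> ->; rewrite invrN mulrN EFinN mulNe oppeK.
pose A : set (R * R) := [set z | (0 < z.1) && (z.1 <= z.2) && (z.2 < 1)].
have mA : measurable A.
  have -> : A = (@fst R R) @^-1` `]0%R, +oo[%classic `&`
      ((@snd R R) @^-1` `]-oo, 1%R[%classic `&` (setT `&` [set z | (z.1 <= z.2)])).
    apply/seteqP; split => z; rewrite /A/= !in_itv/= andbT.
      by case/andP => /andP[].
    by case=> -> [-> [_ ->]].
  apply: measurableI; last (apply: measurableI; last exact: measurable_fun_le).
    by rewrite -[X in measurable X]setTI; exact: measurable_fst.
  by rewrite -[X in measurable X]setTI; exact: measurable_snd.
have := tonelli_product (mpow (a - 1)) (mwt p) mA (fun t => powR_ge0 t (a - 1)) w0.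
have -> : (\int[mu]_t ((t `^ (a - 1))%:E * \int[mu]_(u in xsection A t) (wt p u)%:E))%E =
    (\int[mu]_(t in pos) (t `^ (a - 1) * (model p 1 t - wref a t))%:E)%E.
  rewrite [RHS]integral_mkcond; apply: eq_integral => t _; rewrite /patch.
  case: ifPn => tp.
    have t0 : 0 < t by move: tp; rewrite inE/= in_itv/= andbT.
    rewrite (_ : xsection A t = `[t, 1%R[%classic); last first.
      by apply/seteqP; split => u; rewrite /xsection/= inE /A/= in_itv/= t0.
    by rewrite integral_wt_tail// /wref a0 subr0.
  rewrite (_ : xsection A t = set0) ?integral_set0 ?mule0//.
  apply/seteqP; split => u //; rewrite /xsection/= inE /A/= => /andP[/andP[t0 _] _].
  by move: tp; rewrite notin_setE/= in_itv/= t0.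
have -> : (\int[mu]_u ((wt p u)%:E * \int[mu]_(t in ysection A u) (t `^ (a - 1))%:E))%E =
    ((p / a)%:E * B)%E.
  rewrite /B -ge0_integralZl//; last by rewrite lee_fin divr_ge0 ?ltW.
  rewrite [RHS]integral_mkcond; apply: eq_integral => u _; rewrite /patch.
  case: ifPn => up.
    have /andP[u0 u1] : 0 < u < 1 by move: up; rewrite inE/= in_itv/=.
    rewrite (_ : ysection A u = `]0%R, u]%classic); last first.
      by apply/seteqP; split => t; rewrite /ysection/= inE /A/= in_itv/= u1 andbT.
    rewrite -integral_itv_bndo_bndc; last first.
      by apply: measurable_funTS; apply/measurable_EFinP.
    rewrite integral_powR0// -!EFinM; congr EFin; rewrite /wt; ring.
  rewrite (_ : ysection A u = set0) ?integral_set0 ?mule0//.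
  apply/seteqP; split => t //; rewrite /ysection/= inE /A/= => /andP[/andP[t0 tu] u1].
  by move: up; rewrite notin_setE/= in_itv/= u1 (lt_le_trans t0 tu).
by move=> ->.
Qed.

End BetaMoments.

(** * The normalized radius *)

Section NormalizingFactor.
Context {R : realType}.
Local Notation mu := (@lebesgue_measure R).
Local Notation pos := (`]0%R, +oo[%classic : set R).

Lemma phi_gt0 (h : R -> R) a : nice h -> -1 < a -> a != 0 -> 0 < a * phi a h.
Proof.
move=> nh a1 an0; have [mh h01 [C hC] [T hT]] := nh.
have [a0|a0] := orP (lt_total an0).
  pose T' := Num.max T 1.
  have T'0 : 0 < T' by rewrite lt_max ltr01 orbT.
  have := le_phi nh (nice_step T'0) a1; rewrite phi_step// => H.
  have {}H : phi a h <= T' `^ a / a.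
    apply: H => t t0; rewrite /step; case: ifPn => [_|]; first by case/andP: (h01 t t0).
    by rewrite -leNgt ge_max => /andP[Tt _]; rewrite hT.
  have : a * (T' `^ a / a) <= a * phi a h by rewrite ler_nM2l.
  by apply: lt_le_trans; rewrite mulrC divfK// powR_gt0.
apply: mulr_gt0 => //.
(* Below this [c] the linear bound gives [h t >= 1/2], so [h] dominates half of [step c]. *)
pose c := (2 * (`|C| + 1))^-1.
have C1 : 0 < `|C| + 1 by rewrite ltr_wpDl.
have c0 : 0 < c by rewrite invr_gt0 mulr_gt0.
apply: (@lt_le_trans _ _ (2^-1 * phi a (step c))).
  by rewrite phi_step// mulr_gt0 ?divr_gt0 ?powR_gt0.
rewrite /phi -RintegralZl//; last exact: nice_integrable (nice_step c0) a1.
apply: le_Rintegral => //; last 2 first.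
- exact: nice_integrable.
- move=> t; rewrite /= in_itv/= andbT => t0.
  rewrite mulrCA ler_wpM2l ?powR_ge0// /wref a0 !subr0 /step.
  case: ifPn => tc; last by rewrite mulr0; case/andP: (h01 t t0).
  rewrite mulr1; apply: le_trans (hC t t0).
  have : C * t <= (`|C| + 1) * c.
    apply: (@le_trans _ _ ((`|C| + 1) * t)); last by rewrite ler_wpM2l ?ltW.
    by rewrite ler_wpM2r ?(ltW t0)// (le_trans (ler_norm C))// lerDl.
  rewrite /c invfM mulrCA divff ?gt_eqF// mulr1; lra.
have := @integrableZl _ _ R mu pos (measurable_itv _) (2^-1) _
  (nice_integrable (nice_step c0) a1).
by apply: eq_integrable => // t _; rewrite /= EFinM.
Qed.

(** The pole [a^-1] is [phi a (step 1)], so only the integral of [(t^a - 1) / t * (model - step 1)]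
    is left. On [(0, 1)] the last factor is at most [|C| * t] in absolute value, and the integral of
    [|t^a - 1|] is [|a| / (a + 1) <= 2 |a|]. *)
Lemma phi_model_near0 (p : R) : 0 < p -> exists C : R, forall a, a != 0 ->
  `|a| <= 2^-1 -> `|phi a (model p 1) - a^-1 - phi 0 (model p 1)| <= C * `|a|.
Proof.
move=> p0; have nm := nice_model p0 (@ltr01 R); have ns := nice_step (@ltr01 R).
have [_ h01 [C hC] _] := nm.
exists (2 * `|C|) => a an0; rewrite ler_norml => /andP[a1 a2].
have Na1 : -1 < a by lra.
have N10 : (-1 : R) < 0 by lra.
have N11 : (-1 : R) < 1 by lra.
have a11 : -1 < a + 1 by lra.
have a10 : 0 < a + 1 by lra.
have E1 : phi a (model p 1) - a^-1 =
    (\int[mu]_(t in pos) (t `^ (a - 1) * (model p 1 t - step 1 t)))%R.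
  by rewrite -phiB// phi_step// powR1 div1r.
have E0 : phi 0 (model p 1) =
    (\int[mu]_(t in pos) (t `^ (0 - 1) * (model p 1 t - step 1 t)))%R.
  by rewrite -phiB// phi0_step// ln1 subr0.
have Ia := phiB_integrable nm ns Na1.
have I0 := phiB_integrable nm ns N10.
have Is1 := nice_integrable ns N11.
have Isa := nice_integrable ns a11.
rewrite E1 E0 -RintegralB//.
(* On [(0, 1)], [X t = 1 - t^a], and [s] makes [s * X] equal to [|t^a - 1|]. Its integral is read
   off from [phi_step] at the indices [1] and [a + 1]. *)
pose s : R := if 0 < a then 1 else -1.
pose X t := t `^ (1 - 1) * (step 1 t - wref 1 t) -
  t `^ (a + 1 - 1) * (step 1 t - wref (a + 1) t).
have IX : mu.-integrable pos (EFin \o X).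
  have := @integrableB _ _ R mu pos _ _ _ Is1 Isa.
  by move=> /(_ (measurable_itv _)); apply: eq_integrable => // t _; rewrite /= EFinB.
have ICX : mu.-integrable pos (EFin \o (fun t => (`|C| * s) * X t)).
  have := @integrableZl _ _ R mu pos (measurable_itv _) (`|C| * s) _ IX.
  by apply: eq_integrable => // t _; rewrite /= EFinM.
have Idiff : mu.-integrable pos (EFin \o (fun t => t `^ (a - 1) * (model p 1 t - step 1 t) -
    t `^ (0 - 1) * (model p 1 t - step 1 t))).
  have := @integrableB _ _ R mu pos _ _ _ Ia I0.
  by move=> /(_ (measurable_itv _)); apply: eq_integrable => // t _; rewrite /= EFinB.
apply: le_trans (le_normr_Rintegral _ Idiff) _ => //.
apply: (@le_trans _ _ (\int[mu]_(t in pos) ((`|C| * s) * X t))%R).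
  apply: le_Rintegral => //.
    exact: integrable_norm.
  move=> t; rewrite /= in_itv/= andbT => t0.
  rewrite /X /wref ltr01 a10 !subr0 subrr powRr0 mul1r addrK.
  have tn0 : t != 0 by rewrite gt_eqF.
  rewrite /step; have [t1|t1] := ltP t 1; last first.
    by rewrite (model_eq0 p0 ltr01 t1) !subr0 !mulr0 !subrr normr0 mulr0.
  rewrite mulr1 -mulrBl normrM.
  rewrite (_ : t `^ (a - 1) - t `^ (0 - 1) = (t `^ a - 1) * t^-1); last first.
    by rewrite !powRB ?tn0 ?implybT// powRr0 powRr1 ?ltW//; ring.
  have -> : `|C| * s * (1 - t `^ a) = `|t `^ a - 1| * `|C|.
    rewrite -mulrA mulrC; congr (_ * _); rewrite /s; case: ifPn => a0.
      rewrite mul1r ler0_norm ?opprB// subr_le0 -[leRHS](powRr0 t).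
      by rewrite ger_powR ?t0 ?ltW.
    rewrite mulN1r opprB ger0_norm// subr_ge0 -[leLHS](powRr0 t).
    by rewrite ger_powR ?t0 ?(ltW t1)// leNgt.
  rewrite normrM -mulrA ler_wpM2l// normfV (gtr0_norm t0) distrC.
  have /andP[_ h1] := h01 t t0.
  rewrite ger0_norm ?subr_ge0// mulrC ler_pdivrMr//.
  have := hC t t0; have := ler_norm C.
  move=> h2; have := ler_wpM2r (ltW t0) h2; lra.
rewrite RintegralZl//.
rewrite /X RintegralB// -/(phi 1 (step 1)) -/(phi (a + 1) (step 1)).
rewrite !phi_step ?oner_neq0 ?(gt_eqF a10)// !powR1 divr1.
have -> : 1 - 1 / (a + 1) = a / (a + 1) by field; rewrite gt_eqF.
rewrite -mulrA [2 * `|C|]mulrC -mulrA ler_wpM2l//.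
have -> : s * (a / (a + 1)) = `|a| / (a + 1).
  rewrite mulrA; congr (_ / _); rewrite /s; case: ifPn => a0.
    by rewrite mul1r gtr0_norm.
  by rewrite mulN1r ler0_norm// leNgt.
by rewrite ler_pdivrMr// -mulrA mulrC -mulrA ler_peMr//; lra.
Qed.

Lemma cvg_dnbhs0_linear (g : R -> R) (L K d : R) : 0 < d ->
  (forall a, a != 0 -> `|a| <= d -> `|g a - L| <= K * `|a|) ->
  g a @[a --> 0^'] --> L.
Proof.
move=> d0 H; apply/cvgrPdist_le => e e0; near=> a.
have a0 : a != 0 by near: a; exact: nbhs_dnbhs_neq.
have ad : `|a| <= d.
  by near: a; apply: dnbhs0_le.
rewrite distrC; apply: le_trans (H a a0 ad) _.
have : `|a| <= e / (`|K| + 1) by near: a; apply: dnbhs0_le; rewrite divr_gt0// ltr_wpDl.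
rewrite ler_pdivlMr ?ltr_wpDl// => h; apply: le_trans h.
rewrite mulrC ler_wpM2l// (le_trans (ler_norm K))// lerDl//.
Unshelve. all: by end_near. Qed.

(** The radius of a [nice] profile as a real number. Euler's constant is gone at index [0] because
    [wref 0] has replaced [expR (- t)] as the reference. *)
Definition nrad (a : R) (h : R -> R) : R :=
  if a == 0 then expR (phi 0 h) else (a * phi a h) `^ a^-1.

Lemma nrad_gt0 a h : nice h -> -1 < a -> 0 < nrad a h.
Proof.
move=> nh a1; rewrite /nrad; case: eqVneq => [_|a0]; first exact: expR_gt0.
by rewrite powR_gt0// phi_gt0.
Qed.

(** For [a < 0] multiplication by [a] and the power [a^-1] each reverse the order, and the two
    reversals cancel. *)
Lemma le_nrad a h h' : nice h -> nice h' -> -1 < a -> phi a h <= phi a h' ->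
  nrad a h <= nrad a h'.
Proof.
move=> nh nh' a1 H; rewrite /nrad; case: eqVneq => [a0|an0].
  by rewrite ler_expR -a0.
have h0 := phi_gt0 nh a1 an0; have h'0 := phi_gt0 nh' a1 an0.
have [a0|a0] := orP (lt_total an0); last first.
  have {}H : a * phi a h <= a * phi a h' by rewrite ler_pM2l.
  move: (a * phi a h) (a * phi a h') h0 h'0 H => x y x0 y0 xy.
  by rewrite ge0_ler_powR ?nnegrE ?invr_ge0 ?(ltW a0) ?(ltW x0) ?(ltW y0).
have {}H : a * phi a h' <= a * phi a h by rewrite ler_nM2l.
move: (a * phi a h) (a * phi a h') h0 h'0 H => x y x0 y0 xy.
rewrite -(opprK a^-1) -invrN !(powRN _ (- a)^-1) lef_pV2 ?posrE ?powR_gt0//.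
by rewrite ge0_ler_powR ?nnegrE ?invr_ge0 ?oppr_ge0 ?(ltW a0) ?(ltW x0) ?(ltW y0).
Qed.

Lemma nrad_model p c a : 0 < p -> 0 < c -> -1 < a ->
  nrad a (model p c) = c * nrad a (model p 1).
Proof.
move=> p0 c0 a1; rewrite /nrad; case: eqVneq => [_|an0].
  by rewrite phi0_scale// expRD lnK.
have h0 := phi_gt0 (nice_model p0 (@ltr01 R)) a1 an0.
rewrite phi_scale// mulrCA (powRM _ (powR_ge0 c a) (ltW h0)).
by rewrite -powRrM divff// powRr1// ltW.
Qed.

Lemma nrad_phi_inj a h h' : nice h -> nice h' -> -1 < a -> nrad a h = nrad a h' ->
  phi a h = phi a h'.
Proof.
move=> nh nh' a1; rewrite /nrad; case: eqVneq => [a0|an0].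
  by rewrite a0 => /expR_inj.
have h0 := phi_gt0 nh a1 an0; have h'0 := phi_gt0 nh' a1 an0.
move=> E; apply: (mulfI an0).
move: (a * phi a h) (a * phi a h') h0 h'0 E => x y x0 y0 E.
by rewrite -(powRr1 (ltW x0)) -(powRr1 (ltW y0)) -(mulVf an0) !powRrM E.
Qed.

(** Away from [0] this is [Beta_phi]. At [0] the limit is that of [ln (b * phi b) / b]: with
    [b * phi b = 1 + b * J b] and [J b] tending to [L = phi 0], the expansion of the logarithm at
    [1] gives [L]. *)
Lemma normfacE (n : nat) (s a : R) : 0 < s -> (0 < n)%N -> -1 < a ->
  normfac n s a = (nrad a (model (n%:R + 2 / s) 1))^-1.
Proof.
move=> s0 n0 a1; set p := n%:R + 2 / s.
have p0 : 0 < p by rewrite ltr_wpDl// divr_gt0.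
have nm := nice_model p0 (@ltr01 R).
have fac0E b : -1 < b -> b != 0 ->
    normfac0 n s b = (b * phi b (model p 1)) `^ (- b^-1).
  by move=> b1 b0; rewrite /normfac0 -/p Beta_phi.
rewrite /normfac /nrad; case: eqVneq => [_|an0]; last by rewrite fac0E// powRN.
rewrite -expRN; apply/cvg_lim => //.
have [C HC] := phi_model_near0 p0.
set L := phi 0 (model p 1) in HC *.
pose J a := phi a (model p 1) - a^-1.
pose K := `|L| + `|C|.
have K0 : 0 <= K by rewrite addr_ge0.
(* The first bound keeps [b] in the range of [phi_model_near0]; the second, as [|J b| <= K], keeps
   [|b * J b| <= 1/2]. *)
pose d := Num.min 2^-1 (2^-1 / (K + 1)).
have K1 : 0 < K + 1 by rewrite ltr_wpDl.
have d0 : 0 < d by rewrite lt_min invr_gt0 ltr0n/= divr_gt0.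
pose g (b : R) := ln (b * phi b (model p 1)) / b.
suff gL : g b @[b --> 0^'] --> L.
  apply: (@cvg_trans _ ((expR (- g b)) @[b --> 0^'])).
    apply: near_eq_cvg; near=> b.
    have b0 : b != 0 by near: b; exact: nbhs_dnbhs_neq.
    have b1 : -1 < b.
      have : `|b| <= 2^-1 by near: b; apply: dnbhs0_le.
      by rewrite ler_norml => /andP[b1 _]; lra.
    have bphi := phi_gt0 nm b1 b0.
    by rewrite fac0E// [RHS]/powR gt_eqF//; congr expR; rewrite /g mulNr mulrC.
  apply: continuous_cvg; first exact: continuous_expR.
  exact: cvgN.
(* [2 * K ^+ 2] comes from [|ln (1 + x) - x| <= 2 x^2] with [x = b * J b], and [C] from
   [phi_model_near0]. *)
apply: (@cvg_dnbhs0_linear g L (2 * K ^+ 2 + C) d d0) => b b0.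
rewrite le_min => /andP[b2 bK].
have b1 : -1 < b by move: b2; rewrite ler_norml => /andP[b1 _]; lra.
have JL := HC b b0 b2.
have JK : `|J b| <= K.
  rewrite -(subrK L (J b)) (le_trans (ler_normD _ _))// addrC lerD2l.
  apply: le_trans JL _; apply: (@le_trans _ _ (`|C| * 1)); last by rewrite mulr1.
  apply: (@le_trans _ _ (`|C| * `|b|)); first by rewrite ler_wpM2r// ler_norm.
  rewrite ler_wpM2l//; lra.
have phiE : b * phi b (model p 1) = 1 + b * J b.
  by rewrite /J mulrBr divff// addrC subrK.
pose x := b * J b.
have xb : `|x| <= `|b| * K by rewrite normrM ler_wpM2l.
have x2 : `|x| <= 2^-1.
  apply: le_trans xb _; move: bK; rewrite ler_pdivlMr// mulrDr mulr1.
  by apply: le_trans; rewrite lerDl.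
have x1 : 2^-1 <= 1 + x by move: x2; rewrite ler_norml => /andP[]; lra.
(* The upper bound [ln (1 + y) <= y], read at [1 + y = (1 + x)^-1]. *)
have lnlo : x / (1 + x) <= ln (1 + x).
  have := @le_ln1Dx R ((1 + x)^-1 - 1).
  have -> : 1 + ((1 + x)^-1 - 1) = (1 + x)^-1 by ring.
  have x10 : 0 < 1 + x by lra.
  rewrite lnV ?posrE//.
  have -> : (1 + x)^-1 - 1 = - (x / (1 + x)) by field; apply: lt0r_neq0; lra.
  rewrite lerN2; apply.
  rewrite ltrN2 ltr_pdivrMr; lra.
have lnhi : ln (1 + x) <= x by apply: le_ln1Dx; lra.
have lnx : `|ln (1 + x) - x| <= 2 * x ^+ 2.
  rewrite ler0_norm ?subr_le0// opprB.
  apply: (@le_trans _ _ (x - x / (1 + x))); first by rewrite lerD2l lerN2.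
  have -> : x - x / (1 + x) = x ^+ 2 / (1 + x) by field; apply: lt0r_neq0; lra.
  rewrite mulrC ler_wpM2r ?sqr_ge0// -[leRHS]invrK lef_pV2 ?posrE ?invr_gt0//; lra.
have gJ : `|g b - J b| <= 2 * K ^+ 2 * `|b|.
  rewrite /g phiE -/x.
  have -> : ln (1 + x) / b - J b = (ln (1 + x) - x) / b.
    by rewrite mulrBl /x mulrAC divff// mul1r.
  have nb0 : 0 < `|b| by rewrite normr_gt0.
  rewrite normrM normfV ler_pdivrMr//; apply: le_trans lnx _.
  have -> : 2 * K ^+ 2 * `|b| * `|b| = 2 * (`|b| * K) ^+ 2 by ring.
  rewrite ler_pM2l// -(real_normK (num_real x)).
  by rewrite ler_pXn2r ?nnegrE ?mulr_ge0.
rewrite -(subrK (J b) (g b)) -addrA mulrDl (le_trans (ler_normD _ _))//.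
exact: lerD.
Unshelve. all: by end_near. Qed.

End NormalizingFactor.

(** * Euler's constant *)

Section EulerGamma.
Context {R : realType}.
Local Notation mu := (@lebesgue_measure R).
Local Notation pos := (`]0%R, +oo[%classic : set R).

Lemma phi0_telescope (h h' : R -> R) (m : nat) : nice h -> nice h' ->
  (forall t, 0 < t -> t < 1 -> h t - h' t = t * (1 - t) ^+ m) ->
  (forall t, 1 <= t -> h t = 0 /\ h' t = 0) ->
  phi 0 h - phi 0 h' = m.+1%:R^-1.
Proof.
move=> nh nh' lo hi; rewrite phiB//.
have m0 : 0 < m.+1%:R :> R by [].
have -> : (\int[mu]_(t in pos) (t `^ (0 - 1) * (h t - h' t)))%R =
    (\int[mu]_(t in `]0%R, 1%R[) (m.+1%:R^-1 * (m.+1%:R * (1 - t) `^ (m.+1%:R - 1))))%R.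
  rewrite Rintegral_mkcond [RHS]Rintegral_mkcond; congr Rintegral.
  apply/funext => t; rewrite /patch; have [t0|t0] := ltP 0 t; last first.
    by rewrite !memNset//= in_itv/= ltNge t0.
  rewrite mem_set/= ?in_itv/= ?t0//; have [t1|t1] := ltP t 1.
    rewrite mem_set/= ?in_itv/= ?t0// lo// mulKf ?gt_eqF//.
    rewrite -natr1 addrK powR_mulrn ?subr_ge0 ?(ltW t1)//.
    by rewrite sub0r powR_inv1 ?(ltW t0)// mulKf ?gt_eqF.
  rewrite memNset/= ?in_itv/= ?t0//= -?leNgt//; last by rewrite ltNge t1.
  by have [-> ->] := hi t t1; rewrite subrr mulr0.
have mw : measurable_fun setT (fun t : R => m.+1%:R * (1 - t) `^ (m.+1%:R - 1)).
  apply: measurable_funM => //.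
  apply: (measurableT_comp (measurable_powR (m.+1%:R - 1))).
  exact: measurable_funB.
have tot : (\int[mu]_(t in `]0%R, 1%R[) (m.+1%:R * (1 - t) `^ (m.+1%:R - 1))%:E = 1)%E.
  rewrite integral_itv_obnd_cbnd; last by apply: measurable_funTS; apply/measurable_EFinP.
  by rewrite integral_onem_powR// subr0 powR1.
rewrite RintegralZl//; first by rewrite /Rintegral tot/= mulr1.
apply/integrableP; split; first by apply: measurable_funTS; apply/measurable_EFinP.
rewrite (_ : (\int[mu]_(x in _) _)%E = 1%E) ?ltry// -tot.
by apply: eq_integral => t _; rewrite /= ger0_norm// mulr_ge0 ?powR_ge0.
Qed.

(** Consecutive powers differ by [t * (1 - t)^m]; the factor [t] cancels [1/t], and each difference
    contributes [1 / (m + 1)]. The sum starts at [step 1], the zeroth power on [(0, 1)], where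
    [phi 0] vanishes. *)
Lemma phi0_model_nat (m : nat) :
  phi 0 (model m.+1%:R 1) = - series (@harmonic R) m.+1.
Proof.
have mE (k : nat) (t : R) : t < 1 -> model k.+1%:R 1 t = (1 - t) ^+ k.+1.
  by move=> t1; rewrite modelE ?ltW// divr1 powR_mulrn// subr_ge0 ltW.
have nm (k : nat) : nice (model k.+1%:R 1 : R -> R) by exact: nice_model.
elim: m => [|m IH].
  have H : phi 0 (step 1) - phi 0 (model 1%:R 1) = 1%:R^-1 :> R.
    apply: phi0_telescope => //; first exact: nice_step.
      by move=> t t0 t1; rewrite /step t1 mE// expr1 expr0; ring.
    by move=> t t1; rewrite /step ltNge t1/= model_eq0.
  move: H; rewrite phi0_step// ln1 sub0r => /eqP; rewrite eqr_oppLR => /eqP ->.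
  by rewrite /series/= big_nat1.
have H : phi 0 (model m.+1%:R 1) - phi 0 (model m.+2%:R 1) = m.+2%:R^-1 :> R.
  apply: phi0_telescope => //.
    by move=> t t0 t1; rewrite !mE// [in X in _ - X]exprS; ring.
  by move=> t t1; rewrite !model_eq0.
rewrite /series/= big_nat_recr//= opprD -/(series (@harmonic R) m.+1) -IH -H; ring.
Qed.

Lemma model_exp_le (m : nat) (t : R) : (0 < m)%N -> 0 <= t ->
  model m%:R m%:R t <= expR (- t).
Proof.
move=> m0 t0; have m0' : 0 < m%:R :> R by rewrite ltr0n.
rewrite /model powR_mulrn ?le_max ?lexx//.
have -> : - t = m%:R * - (t / m%:R) by field; rewrite gt_eqF.
rewrite expRM_natl lerXn2r ?nnegrE ?le_max ?lexx ?expR_ge0//.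
by rewrite ge_max expR_ge0/=; exact: expR_ge1Dx.
Qed.

(** With [x = t/m], [(1 - x) e^x >= 1 - x^2]; the [m]-th power of this is at least [1 - t^2/m] by
    Bernoulli. *)
Lemma model_exp_ge (m : nat) (t : R) : (0 < m)%N -> 0 <= t -> t <= m%:R ->
  expR (- t) - t ^+ 2 / m%:R <= model m%:R m%:R t.
Proof.
move=> m0 t0 tm; have m0' : 0 < m%:R :> R by rewrite ltr0n.
pose x := t / m%:R.
have x0 : 0 <= x by rewrite divr_ge0// ltW.
have x1 : x <= 1 by rewrite ler_pdivrMr// mul1r.
have mx : m%:R * x = t by rewrite /x mulrC divfK// gt_eqF.
rewrite modelE// -/x powR_mulrn ?subr_ge0//.
have e0 := expR_gt0 t.
have H : 1 - t ^+ 2 / m%:R <= (1 - x) ^+ m * expR t.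
  have -> : t ^+ 2 / m%:R = m%:R * x ^+ 2 by rewrite /x; field; rewrite gt_eqF.
  apply: (le_trans (@bernoulli_expr R (x ^+ 2) m _)); first by rewrite expr_le1.
  rewrite -mx expRM_natl -exprMn lerXn2r ?nnegrE ?mulr_ge0 ?subr_ge0 ?expR_ge0//.
    by rewrite expr_le1.
  have -> : 1 - x ^+ 2 = (1 - x) * (1 + x) by ring.
  by rewrite ler_wpM2l ?subr_ge0// expR_ge1Dx.
have e1 : expR (- t) <= 1 by rewrite -expR0 ler_expR oppr_le0.
have en0 := expR_gt0 (- t).
have := ler_wpM2r (ltW en0) H; rewrite -[X in _ <= X]mulrA expRxMexpNx_1 mulr1.
apply: le_trans; rewrite mulrBl mul1r lerD2l lerN2 ler_piMr//.
by rewrite divr_ge0// ?sqr_ge0// ltW.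
Qed.

(* Dominated convergence along [(1 - t/m)^m -> exp (- t)]: by scaling and telescoping, the
   corresponding integral for the model is [ln m - (1 + 1/2 + ... + 1/m)]. *)
Lemma euler_gammaE :
  mu.-integrable pos (EFin \o (fun t => t^-1 * (expR (- t) - wref 0 t))) /\
  (\int[mu]_(t in pos) (t^-1 * (expR (- t) - wref 0 t))%:E = (- @euler_gamma R)%:E)%E.
Proof.
pose f (n : nat) (t : R) : \bar R := (t `^ (0 - 1) * (model n.+1%:R n.+1%:R t - wref 0 t))%:E.
pose f0 (t : R) : \bar R := (t `^ (0 - 1) * (expR (- t) - wref 0 t))%:E.
(* The dominating function: for [t < 1] Bernoulli gives [1 - model <= t], and for [t >= 1] the model
   is at most [exp (- t) <= 2 / t^2]. *)
pose g (t : R) : R := if t < 1 then 1 else 2 * t `^ (- 2).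
have nm (n : nat) : nice (model n.+1%:R n.+1%:R : R -> R) by exact: nice_model.
have N10 : (-1 : R) < 0 by lra.
have fi n := nice_integrable (nm n) N10.
have mg : measurable_fun setT g.
  apply: measurable_fun_if => //.
    by apply: measurable_fun_ltr.
  by apply: measurable_funTS; apply: measurable_funM => //; exact: measurable_powR.
have gi : mu.-integrable pos (EFin \o g).
  apply: (@integrable_power_bound R g 2 0 (- 2)) => //; try lra.
  - exact: measurable_funTS.
  - by move=> t t0 t1; rewrite /g t1 powRr0 normr1; lra.
  - by move=> t t1; rewrite /g ltNge t1/= ger0_norm// mulr_ge0 ?powR_ge0.
have exp2 (t : R) : 1 <= t -> expR (- t) <= 2 * t `^ (- 2).
  move=> t1; have t0 : 0 < t by lra.
  rewrite expRN powRN -[2%:R]/(2%:R) powR_mulrn ?(ltW t0)//.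
  have := @expR_ge1Dxn R t 1 (ltW t0); rewrite (_ : 2`!%:R = 2)// => h.
  have t20 : 0 < t ^+ 2 by rewrite exprn_gt0.
  rewrite -[leRHS]invf_div lef_pV2 ?posrE ?expR_gt0 ?divr_gt0//; lra.
have mf n : measurable_fun pos (f n) by have /integrableP[] := fi n.
have mf0 : measurable_fun pos f0.
  apply: measurable_funTS; apply/measurable_EFinP; apply: measurable_funM.
    exact: measurable_powR.
  apply: measurable_funB; last exact: measurable_wref.
  by apply: measurableT_comp => //; exact: measurable_expR.
have := @dominated_convergence _ _ R mu pos (measurable_itv _) f f0 (EFin \o g) mf mf0.
case.
- apply: aeW => t /=; rewrite in_itv/= andbT => t0.
  apply: cvg_EFin; first exact: nearW.
  apply: cvgM; first exact: cvg_cst.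
  apply: cvgB; last exact: cvg_cst.
  apply: (@squeeze_cvgr _ _ _ R (fun n : nat => expR (- t) - t ^+ 2 * n.+1%:R^-1)
    (fun=> expR (- t))).
  + near=> n; rewrite model_exp_le ?(ltW t0)// andbT model_exp_ge ?(ltW t0)//.
    near: n; apply: filterS (nbhs_infty_ger t) => n tn.
    by rewrite (le_trans tn)// ler_nat.
  + rewrite -[X in _ --> X]subr0; apply: cvgB; first exact: cvg_cst.
    rewrite -(mulr0 (t ^+ 2)); apply: cvgMr; exact: cvg_harmonic.
  + exact: cvg_cst.
- exact: gi.
- apply: aeW => t n /=; rewrite in_itv/= andbT => t0.
  rewrite /f lee_fin /wref ltxx /g.
  have [_ h01 _ _] := nm n; have /andP[h0 h1] := h01 t t0.
  rewrite sub0r powR_inv1 ?(ltW t0)// normrM normfV (gtr0_norm t0).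
  case: ifPn => t1.
    rewrite mulrC ler_pdivrMr// mul1r ler0_norm ?subr_le0// opprB.
    have n1 : 1 <= n.+1%:R :> R by rewrite ler1n.
    rewrite modelE ?powR_mulrn ?subr_ge0//; last 2 first.
    + by rewrite ler_pdivrMr// mul1r (le_trans (ltW t1)).
    + by rewrite (le_trans (ltW t1)).
    have := @bernoulli_expr R (t / n.+1%:R) n.+1.
    rewrite [_%:R * _]mulrC divfK ?gt_eqF// => H.
    have := H _; rewrite ler_pdivrMr// mul1r (le_trans (ltW t1))// => /(_ isT); lra.
  rewrite -leNgt in t1; rewrite subr0 ger0_norm//.
  apply: le_trans (exp2 t t1); rewrite mulrC ler_pdivrMr//.
  apply: (@le_trans _ _ (expR (- t))); first exact: model_exp_le (ltW t0).
  by rewrite ler_peMr// expR_ge0.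
move=> f0i _ fl.
have E : {in pos, f0 =1 (EFin \o (fun t => t^-1 * (expR (- t) - wref 0 t)))}.
  move=> t; rewrite inE/= in_itv/= andbT => t0.
  by rewrite /f0 sub0r powR_inv1// ltW.
split; first exact: eq_integrable f0i.
transitivity (\int[mu]_(t in pos) f0 t)%E.
  by apply: eq_integral => t tp; rewrite (E t tp).
have fE n : (\int[mu]_(t in pos) f n t = (ln n.+1%:R - series (@harmonic R) n.+1)%:E)%E.
  rewrite -phi0_model_nat -phi0_scale// /phi /Rintegral fineK//.
  by apply: integrable_fin_num => //; exact: fi.
have f0fin : (\int[mu]_(t in pos) f0 t)%E \is a fin_num by exact: integrable_fin_num.
rewrite -(fineK f0fin); congr EFin.
have {}fl : (ln n.+1%:R - series (@harmonic R) n.+1) @[n --> \oo] -->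
    fine (\int[mu]_(t in pos) f0 t)%E.
  have /fine_cvgP[_] : EFin \o (fun n : nat => ln n.+1%:R - series (@harmonic R) n.+1) @ \oo
      --> (fine (\int[mu]_(t in pos) f0 t)%E)%:E.
    rewrite fineK//; apply: cvg_trans fl; apply: near_eq_cvg; apply: nearW => n /=.
    by rewrite fE.
  by apply: cvg_trans; apply: near_eq_cvg; apply: nearW.
apply/esym; rewrite -[RHS]opprK; congr (- _).
(* [f n] carries the index [n.+1], so the sequence defining [euler_gamma] is shifted by one. *)
apply/cvg_lim => //; rewrite -cvg_shiftS.
under eq_fun do rewrite -opprB.
exact: cvgN.
Unshelve. all: by end_near. Qed.

End EulerGamma.

(** * Comparison of the radii *)

Section Radial.
Context {R : realType}.
Local Notation mu := (@lebesgue_measure R).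
Local Notation pos := (`]0%R, +oo[%classic : set R).

Definition profile_radius (a : R) (h : R -> R) : \bar R :=
  if 0 < a then
    eroot (a%:E * \int[mu]_(t in pos) (t `^ (a - 1) * h t)%:E)%E a
  else if a < 0 then
    eroot (`|a|%:E * \int[mu]_(t in pos) (t `^ (a - 1) * (1 - h t))%:E)%E a
  else
    expeR ((- euler_gamma R)%:E + \int[mu]_(t in pos) (t^-1 * (h t - expR (- t)))%:E)%E.

Lemma radialR_profile (n : nat) (s : R) (f : 'rV[R]_n -> R) (xi : 'rV[R]_n) (a : R) :
  0 < s -> s_concave s f -> (L2norm2 f < +oo)%E -> L2norm2 f != 0%E ->
  radialR a f xi = profile_radius a (cov_profile f xi).
Proof.
move=> s0 fc fy fn0; rewrite /radialR /profile_radius.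
set N := fine (L2norm2 f); set h := cov_profile f xi.
have N0 : 0 < N by apply: (@L2norm2_gt0 R n s f xi).
have cE t : covf f xi t = (N * h t)%:E  by apply: (@covfE R n s f xi).
have dE t : diff2f f xi t = (2 * N * (1 - h t))%:E  by apply: (@diff2fE R n s f xi).
have h0 t : 0 <= h t  by apply: (@cov_profile_ge0 R n s f xi).
have h1 t : h t <= 1  by apply: (@cov_profile_le1 R n s f xi).
have mh : measurable_fun setT h by apply: (@measurable_cov_profile R n s f xi).
have mp : measurable_fun setT (fun t : R => t `^ (a - 1)) by exact: measurable_powR.
have aux (k c : R) (u : R -> R) : 0 < c -> measurable_fun setT u -> (forall t, 0 <= u t) ->
    ((k / c)%:E * \int[mu]_(t in pos) ((t `^ (a - 1))%:E * (c * u t)%:E) =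
     k%:E * \int[mu]_(t in pos) (t `^ (a - 1) * u t)%:E)%E.
  move=> c0 mu_ u0.
  have -> : (\int[mu]_(t in pos) ((t `^ (a - 1))%:E * (c * u t)%:E) =
      \int[mu]_(t in pos) (c%:E * (t `^ (a - 1) * u t)%:E))%E.
    by apply: eq_integral => t _; rewrite -!EFinM mulrCA.
  rewrite ge0_integralZl//.
  - by rewrite muleA -EFinM divfK ?gt_eqF.
  - by apply: measurable_funTS; apply/measurable_EFinP; exact: measurable_funM.
  - by move=> t _; rewrite lee_fin mulr_ge0 ?powR_ge0.
  - by rewrite lee_fin ltW.
case: ifPn => a0.
  congr eroot; rewrite -(aux a N h)//.
  by congr (_ * _)%E; apply: eq_integral => t _; rewrite cE.
case: ifPn => a0'.
  congr eroot; rewrite -(aux _ (2 * N)) ?mulr_gt0//.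
  - by congr (_ * _)%E; apply: eq_integral => t _; rewrite dE.
  - exact: measurable_funB.
  - by move=> t; rewrite subr_ge0.
congr (expeR (_ + _))%E; apply: eq_integral => t _.
have NK : N * h t * N^-1 = h t by rewrite mulrAC divff ?gt_eqF// mul1r.
rewrite cE; change ((t^-1 * (N * h t * N^-1 - expR (- t)))%:E = (t^-1 * (h t - expR (- t)))%:E).
by rewrite NK.
Qed.

(** At index [0], passing from [expR (- t)] to [wref 0] adds [euler_gamma] by [euler_gammaE], which
    cancels the constant in front. For [a < 0] positivity of [a * phi a h] excludes the infinite
    value of [eroot]. *)
Lemma profile_radius_nice a h : nice h -> -1 < a ->
  profile_radius a h = (nrad a h)%:E.
Proof.
move=> nh a1; have [mh h01 _ _] := nh.
have phiE b : -1 < b ->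
    (\int[mu]_(t in pos) (t `^ (b - 1) * (h t - wref b t))%:E = (phi b h)%:E)%E.
  by move=> b1; rewrite /phi /Rintegral fineK//; apply: integrable_fin_num => //; exact: nice_integrable.
rewrite /profile_radius /nrad.
have [a0|a0|a0] := ltrgtP 0 a.
- rewrite /eroot a0.
  rewrite (_ : (\int[mu]_(t in pos) _)%E = (phi a h)%:E); last first.
    by rewrite -phiE//; apply: eq_integral => t _; rewrite /wref a0 subr0.
  by rewrite -EFinM poweR_EFin.
- rewrite /eroot ltNge (ltW a0)/=.
  rewrite (_ : (\int[mu]_(t in pos) _)%E = (- phi a h)%:E); last first.
    apply: oppe_inj; rewrite -EFinN opprK -phiE// -integral_ge0N; last first.
      move=> t; rewrite /= in_itv/= andbT => t0; have /andP[_ h1] := h01 t t0.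
      by rewrite lee_fin mulr_ge0 ?powR_ge0 ?subr_ge0.
    apply: eq_integral => t _; rewrite -EFinN; congr EFin.
    by rewrite /wref ltNge (ltW a0)/= a0; ring.
  rewrite ltr0_norm// -EFinM mulrNN gt_eqF//.
  by apply: phi_gt0 => //; rewrite lt_eqF.
have [gi gE] := @euler_gammaE R.
rewrite (_ : (\int[mu]_(t in pos) _)%E = (phi 0 h + euler_gamma R)%:E); last first.
  rewrite EFinD -phiE//.
  rewrite -[X in (_ + X)%E]oppeK -EFinN -gE -integralB//; last exact: nice_integrable.
  apply: eq_integral => t; rewrite inE/= in_itv/= andbT => t0.
  rewrite -EFinB; congr EFin; rewrite sub0r powR_inv1 ?(ltW t0)//; ring.
by rewrite -EFinD/= addrCA addNr addr0.
Qed.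

Lemma le_integral_general (f g : R -> \bar R) (D : set R) :
  (forall x, D x -> f x <= g x)%E ->
  (\int[mu]_(x in D) f x <= \int[mu]_(x in D) g x)%E.
Proof.
move=> fg; rewrite integralE [leRHS]integralE; apply: leeB.
  apply: le_lower_integral => x Dx; first exact: funepos_ge0.
  by rewrite !funeposE ge_max !le_max lexx orbT andbT fg.
apply: le_lower_integral => x Dx; first exact: funeneg_ge0.
by rewrite !funenegE ge_max !le_max lexx orbT andbT leeN2 fg.
Qed.

Lemma eroot_anti (x y : \bar R) a : a < 0 -> (0 <= x)%E -> (x <= y)%E ->
  (eroot y a <= eroot x a)%E.
Proof.
move=> a0; rewrite /eroot ltNge (ltW a0)/=.
case: x => [x| |]; case: y => [y| |] //=; rewrite ?lee_fin ?leye_eq//.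
  move=> x0 xy; case: (eqVneq x 0) => [_|xn0]; first by rewrite leey.
  have xp : 0 < x by rewrite lt_neqAle eq_sym xn0.
  have yp := lt_le_trans xp xy.
  rewrite gt_eqF// lee_fin -(opprK a^-1) -invrN !(powRN _ (- a)^-1).
  rewrite lef_pV2 ?posrE ?powR_gt0//.
  by rewrite ge0_ler_powR ?nnegrE ?invr_ge0 ?oppr_ge0 ?(ltW a0) ?(ltW xp) ?(ltW yp).
by move=> _ _; case: ifP => _; rewrite ?leey// lee_fin powR_ge0.
Qed.

Lemma profile_radius_ge0 a h : (0 <= profile_radius a h)%E.
Proof.
have eroot_ge0 x b : (0 <= eroot x b :> \bar R)%E.
  rewrite /eroot; case: ifP => _; first exact: poweR_ge0.
  by case: x => [x| |]//; case: ifP => _; rewrite ?leey// lee_fin powR_ge0.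
by rewrite /profile_radius; case: ifP => _; [|case: ifP => _]; rewrite ?eroot_ge0 ?expeR_ge0.
Qed.

(** Meant for degenerate [h] that are not [nice], whose integrals may be infinite; they are compared
    with models directly. *)
Lemma le_profile_radius a h h' :
  (forall t, 0 < t -> 0 <= h t) -> (forall t, 0 < t -> h' t <= 1) ->
  (forall t, 0 < t -> h t <= h' t) ->
  (profile_radius a h <= profile_radius a h')%E.
Proof.
move=> h0 h'1 hh'; rewrite /profile_radius.
have posP t : pos t -> 0 < t by rewrite /= in_itv/= andbT.
case: ifPn => a0.
  have I0 : (0 <= \int[mu]_(t in pos) (t `^ (a - 1) * h t)%:E)%E.
    by apply: integral_ge0 => t /posP t0; rewrite lee_fin mulr_ge0 ?powR_ge0 ?h0.
  have I1 : (\int[mu]_(t in pos) (t `^ (a - 1) * h t)%:E <=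
      \int[mu]_(t in pos) (t `^ (a - 1) * h' t)%:E)%E.
    by apply: le_integral_general => t /posP t0; rewrite lee_fin ler_wpM2l ?powR_ge0 ?hh'.
  rewrite /eroot a0; apply: gt0_ler_poweR.
  - by rewrite invr_ge0 ltW.
  - by rewrite in_itv/= leey andbT mule_ge0// lee_fin ltW.
  - rewrite in_itv/= leey andbT mule_ge0//; first by rewrite lee_fin ltW.
    exact: le_trans I1.
  - by apply: lee_wpmul2l => //; rewrite lee_fin ltW.
case: ifPn => a0'.
  apply: eroot_anti => //.
    rewrite mule_ge0//; apply: integral_ge0 => t /posP t0.
    by rewrite lee_fin mulr_ge0 ?powR_ge0 ?subr_ge0 ?h'1.
  apply: lee_wpmul2l; first by rewrite lee_fin.
  apply: le_integral_general => t /posP t0.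
  by rewrite lee_fin ler_wpM2l ?powR_ge0// lerD2l lerN2 hh'.
rewrite lee_expeR leeD2l//; apply: le_integral_general => t /posP t0.
by rewrite lee_fin ler_wpM2l ?invr_ge0 ?(ltW t0)// lerD2r hh'.
Qed.

Lemma ratio_le (A B x y : R) : 0 < B -> y <= x / A * B ->
  (B^-1%:E * y%:E <= A^-1%:E * x%:E)%E.
Proof. by move=> B0 H; rewrite -!EFinM lee_fin mulrC [leRHS]mulrC ler_pdivrMr. Qed.

End Radial.

Theorem theorem21 (R : realType) (n : nat) (s : R) (f : 'rV[R]_n -> R) :
  0 < s ->
  s_concave s f ->
  (L2norm2 f < +oo)%E ->
  L2norm2 f != 0%E ->
  forall alpha beta : R, -1 < alpha -> alpha < beta ->
  forall xi : 'rV[R]_n, unit_sphere xi ->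
    ((normfac n s beta)%:E * radialR beta f xi
       <= (normfac n s alpha)%:E * radialR alpha f xi)%E.
Proof.
move=> s0 fc fy fn0 a b a1 ab xi sxi.
have n0 : (0 < n)%N.
  rewrite lt0n; apply/eqP => n0; move: sxi; rewrite /unit_sphere.
  rewrite big1 => [/eqP|i _]; first by rewrite eq_sym oner_eq0.
  by have := ltn_ord i; rewrite [X in (_ < X)%N]n0.
have b1 : -1 < b := lt_trans a1 ab.
rewrite (radialR_profile xi a s0 fc fy fn0) (radialR_profile xi b s0 fc fy fn0).
rewrite (normfacE s0 n0 a1) (normfacE s0 n0 b1).
set p := n%:R + 2 / s; set h := cov_profile f xi.
have p0 : 0 < p by rewrite ltr_wpDl// divr_gt0.
have h0 t : 0 <= h t  by apply: (@cov_profile_ge0 R n s f xi).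
have h1 t : h t <= 1  by apply: (@cov_profile_le1 R n s f xi).
have hp : profile p h.
  split.
  - by apply: (@measurable_cov_profile R n s f xi).
  - by move=> t; rewrite h0 h1.
  - by apply: (@cov_profile0 R n s f xi).
  - by rewrite /p addrC => l x y; apply: (@cov_profile_concave R n s f xi).
have nm1 := nice_model p0 (@ltr01 R).
have ra0 := nrad_gt0 nm1 a1; have rb0 := nrad_gt0 nm1 b1.
have model1 c t : 0 < c -> 0 < t -> 0 <= model p c t <= 1.
  by move=> c0; have [_ + _ _] := nice_model p0 c0; apply.
(* If [h] vanishes on [(0, +oo)], it lies below the models of every size [c], so its radius is
   [0]. *)
have [[t0 t00 ht0]|H0] := pselect (exists2 t, 0 < t & 0 < h t); last first.
  have hE t : 0 < t -> h t <= 0.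
    by move=> tp; rewrite leNgt; apply/negP => ht; apply: H0; exists t.
  have rb_le c : 0 < c -> (profile_radius b h <= (c * nrad b (model p 1))%:E)%E.
    move=> c0; rewrite -nrad_model// -profile_radius_nice//; last exact: nice_model.
    apply: le_profile_radius => t tp; first exact: h0.
      by have /andP[] := model1 c t c0 tp.
    by rewrite (le_trans (hE t tp))//; have /andP[] := model1 c t c0 tp.
  have rb : (profile_radius b h <= 0)%E.
    apply/lee_addgt0Pr => e e0; rewrite add0e.
    have := rb_le _ (divr_gt0 e0 rb0).
    by rewrite divfK// (gt_eqF rb0).
  have Va0 : (0 <= (nrad a (model p 1))^-1%:E)%E by rewrite lee_fin invr_ge0; exact: ltW ra0.
  have Vb0 : (0 <= (nrad b (model p 1))^-1%:E)%E by rewrite lee_fin invr_ge0; exact: ltW rb0.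
  apply: (@le_trans _ _ 0%E); first exact: mule_ge0_le0 Vb0 rb.
  exact: mule_ge0 Va0 (profile_radius_ge0 a h).
(* If [h] is [1] throughout, it lies above the models of every size, and the radius at [a] is
   infinite. *)
have [[t1 t10 ht1]|H1] := pselect (exists2 t, 0 < t & h t < 1); last first.
  have hE t : 0 < t -> 1 <= h t.
    by move=> tp; rewrite leNgt; apply/negP => ht; apply: H1; exists t.
  have ra_ge c : 0 < c -> ((c * nrad a (model p 1))%:E <= profile_radius a h)%E.
    move=> c0; rewrite -nrad_model// -profile_radius_nice//; last exact: nice_model.
    apply: le_profile_radius => t tp; last 1 first.
    - by rewrite (le_trans _ (hE t tp))//; have /andP[] := model1 c t c0 tp.
    - by have /andP[] := model1 c t c0 tp.
    - exact: h1.
  have -> : profile_radius a h = +oo%E.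
    apply/eqyP => r r0.
    have := ra_ge _ (divr_gt0 r0 ra0).
    by rewrite divfK// (gt_eqF ra0).
  have Va0 : (0 < (nrad a (model p 1))^-1%:E)%E by rewrite lte_fin invr_gt0; exact: ra0.
  rewrite [leRHS](gt0_muley Va0); exact: leey.
have nh : nice h := nice_profile p0 hp t00 ht0 t10 ht1.
(* By homogeneity this is the size at which the model has the same radius as [h] at index [a], hence
   the same [phi a]. *)
pose c := nrad a h / nrad a (model p 1).
have c0 : 0 < c := divr_gt0 (nrad_gt0 nh a1) ra0.
have nmc := nice_model p0 c0.
have E : phi a h = phi a (model p c).
  apply: (nrad_phi_inj nh nmc a1).
  by rewrite (nrad_model p0 c0 a1) /c divfK// (gt_eqF ra0).
have [u [u0 lo hi]] := profile_crossing p0 hp c0 nh.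
have := le_nrad nh nmc b1 (phi_crossing nh nmc a1 ab u0 lo hi E).
rewrite (nrad_model p0 c0 b1) (profile_radius_nice nh a1) (profile_radius_nice nh b1).
exact: ratio_le rb0.
Qed.
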